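(* Let $A,B$ be real symmetric $3\times 3$ matrices. Then the weak interlacing property and the interlacing property hold for $A,B$.
   Context: All matrices are real and $\otimes$ is the Kronecker product. Let $T\in\mathbb{R}^{n^2\times n^2}$ be the commutation matrix, i.e. $T\operatorname{vec}(X)=\operatorname{vec}(X^\top)$ for all $X\in\mathbb{R}^{n\times n}$, where $\operatorname{vec}$ stacks columns. A vector $x\in\mathbb{R}^{n^2}$ is symmetric if $Tx=x$ and skew-symmetric if $Tx=-x$. For symmetric $n\times n$ matrices $A,B$, $C:=A\otimes B+B\otimes A$ is a symmetric matrix commuting with $T$, so it has an orthonormal eigenbasis in which each eigenvector is either symmetric or skew-symmetric. The even eigenvalues of $C$ are its eigenvalues (with multiplicity) on the subspace of symmetric vectors, $\lambda_1\ge\cdots\ge\lambda_s$, $s=n(n+1)/2$; the odd eigenvalues are its eigenvalues (with multiplicity) on the subspace of skew-symmetric vectors, $\beta_1\ge\cdots\ge\beta_t$, $t=n(n-1)/2$. Interlacing property: $\lambda_i\ge\beta_i\ge\lambda_{s-t+i}$ for all $i\in\{1,\dots,t\}$. Weak interlacing property: $\min_{Tu=u}\frac{u^\top(A\otimes B)u}{u^\top u}\le\min_{Tw=-w}\frac{w^\top(A\otimes B)w}{w^\top w}$ and $\max_{Tw=-w}\frac{w^\top(A\otimes B)w}{w^\top w}\le\max_{Tu=u}\frac{u^\top(A\otimes B)u}{u^\top u}$, over nonzero vectors. *)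

(* Defs.v *)
From HB Require Import structures.
From mathcomp Require Import all_boot all_order all_algebra.
From mathcomp Require Import mxtens.
From mathcomp Require Import boolp classical_sets reals.

Set Implicit Arguments.
Unset Strict Implicit.
Unset Printing Implicit Defensive.

Import Order.TTheory GRing.Theory Num.Theory.

Local Open Scope ring_scope.

Section Commutation.
Variables (R : realType) (n : nat).

(* Column stacking: [mxtens_index (j, i)] is the position [j * n + i], the
   indexing used by the Kronecker product [A *t B] of mxtens. *)
Definition vec (X : 'M[R]_n) : 'cV[R]_(n * n) :=
  \col_k X (mxtens_unindex k).2 (mxtens_unindex k).1.

Definition commutation_mx : 'M[R]_(n * n) :=
  \matrix_(k < n * n, l < n * n)
    [&& (mxtens_unindex k).1 == (mxtens_unindex l).2
      & (mxtens_unindex k).2 == (mxtens_unindex l).1]%:R.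

Definition kron_sym (A B : 'M[R]_n) : 'M[R]_(n * n) := A *t B + B *t A.

(* T stands for [commutation_mx]: row space of the x^T such that T x = x, resp.
   T x = - x (see [symm_spaceP] and [skew_spaceP]). *)
Definition symm_space : 'M[R]_(n * n) := eigenspace commutation_mx^T 1.
Definition skew_space : 'M[R]_(n * n) := eigenspace commutation_mx^T (-1).

End Commutation.

Arguments commutation_mx {R n}.
Arguments symm_space {R n}.
Arguments skew_space {R n}.

(* [l] is the nonincreasing list, with multiplicity, of the eigenvalues of the
   restriction of x |-> M x to the M-invariant space whose transposed vectors
   are the row space of [V].  As [restrictmx] acts on row vectors, [M] is
   transposed. *)
Definition eigenvalues_on (R : realType) (m : nat) (V M : 'M[R]_m)
    (l : seq R) : Prop :=
  sorted >=%R l /\ char_poly (restrictmx V M^T) = \prod_(x <- l) ('X - x%:P).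

(* By [eigenvalues_on_unique] below, the lists [lam] and [bet] are determined
   by A and B.  They are indexed from 0. *)
Definition interlacing (R : realType) (n : nat) (A B : 'M[R]_n) : Prop :=
  let s := (n * n.+1)./2 in
  let t := (n * n.-1)./2 in
  exists (lam : s.-tuple R) (bet : t.-tuple R),
    [/\ eigenvalues_on symm_space (kron_sym A B) lam,
        eigenvalues_on skew_space (kron_sym A B) bet
      & forall i : nat, (i < t)%N ->
          lam`_i >= bet`_i /\ bet`_i >= lam`_(s - t + i)].

Definition rayleigh (R : realType) (m : nat) (M : 'M[R]_m) (u : 'cV[R]_m) : R :=
  (u^T *m M *m u) 0 0 / (u^T *m u) 0 0.

Local Open Scope classical_set_scope.

Definition symm_rayleigh (R : realType) (n : nat) (M : 'M[R]_(n * n)) : set R :=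
  [set rayleigh M u | u in [set u | u != 0 /\ commutation_mx *m u = u]].

Definition skew_rayleigh (R : realType) (n : nat) (M : 'M[R]_(n * n)) : set R :=
  [set rayleigh M w | w in [set w | w != 0 /\ commutation_mx *m w = - w]].

Definition is_min (R : realType) (S : set R) (x : R) : Prop := S x /\ lbound S x.
Definition is_max (R : realType) (S : set R) (x : R) : Prop := S x /\ ubound S x.

(* The minima and maxima are required to be attained.  For n = 1 the
   skew-symmetric vectors are all zero and the property fails. *)
Definition weak_interlacing (R : realType) (n : nat) (A B : 'M[R]_n) : Prop :=
  exists umin wmin umax wmax : R,
    [/\ is_min (symm_rayleigh (A *t B)) umin,
        is_min (skew_rayleigh (A *t B)) wmin,
        is_max (symm_rayleigh (A *t B)) umax
      & is_max (skew_rayleigh (A *t B)) wmax] /\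
    (umin <= wmin /\ wmax <= umax).

Section Facts.
Variables (R : realType) (n : nat).
Implicit Types (X A B : 'M[R]_n) (x : 'cV[R]_(n * n)).

Lemma mul_commutation_mxE p (M : 'M[R]_(n * n, p)) (i j : 'I_n) k :
  (commutation_mx *m M) (mxtens_index (i, j)) k = M (mxtens_index (j, i)) k.
Proof.
rewrite mxE (bigD1 (mxtens_index (j, i))) //= big1 => [|l].
  by rewrite mxE !mxtens_indexK !eqxx mul1r addr0.
case: (mxtens_indexP l) => a b ne; rewrite mxE !mxtens_indexK /=.
case: eqP => [ib|_]; last by rewrite mul0r.
case: eqP => [ja|_]; last by rewrite mul0r.
by rewrite ib ja eqxx in ne.
Qed.

Lemma trmx_commutation : commutation_mx^T = commutation_mx :> 'M[R]_(n * n).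
Proof. by apply/matrixP => k l; rewrite !mxE andbC eq_sym [X in _ && X]eq_sym. Qed.

Lemma commutation_mx_tens A B :
  commutation_mx *m (A *t B) = (B *t A) *m commutation_mx.
Proof.
rewrite -[RHS]trmxK trmx_mul trmx_commutation trmx_tens.
apply/matrixP => k l; case: (mxtens_indexP k) => i j.
case: (mxtens_indexP l) => i' j'.
by rewrite [RHS]mxE !mul_commutation_mxE !tensmxE !mxE mulrC.
Qed.

Lemma commutation_mx_vec X : commutation_mx *m vec X = vec X^T.
Proof.
apply/matrixP => k l; rewrite ord1; case: (mxtens_indexP k) => i j.
by rewrite mul_commutation_mxE !mxE !mxtens_indexK.
Qed.

Lemma tensmx_vec A B X : (A *t B) *m vec X = vec (B *m X *m A^T).
Proof.
apply/matrixP => k l; rewrite ord1; case: (mxtens_indexP k) => i j.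
rewrite !mxE mxtens_indexK /=.
transitivity (\sum_a \sum_b A i a * B j b * X b a).
  rewrite pair_big /= (reindex (@mxtens_unindex n n)) /=; last first.
    by exists (@mxtens_index n n) => ? _; rewrite (mxtens_indexK, mxtens_unindexK).
  by apply: eq_bigr => k' _; rewrite !mxE !mxtens_indexK.
apply: eq_bigr => a _; rewrite mxE mxE mulr_suml.
by apply: eq_bigr => b _; rewrite -mulrA mulrC.
Qed.

Lemma symm_spaceP x :
  reflect (commutation_mx *m x = x) (x^T <= symm_space)%MS.
Proof.
apply: (iffP eigenspaceP); rewrite scale1r -trmx_mul; first exact: trmx_inj.
by move->.
Qed.

Lemma skew_spaceP x :
  reflect (commutation_mx *m x = - x) (x^T <= skew_space)%MS.
Proof.
apply: (iffP eigenspaceP); rewrite scaleN1r -trmx_mul -raddfN.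
  exact: trmx_inj.
by move->.
Qed.

Lemma kron_sym_comm A B : comm_mx commutation_mx (kron_sym A B).
Proof.
by rewrite /comm_mx mulmxDr mulmxDl !commutation_mx_tens addrC.
Qed.

Lemma symm_space_stable A B : stablemx symm_space (kron_sym A B)^T.
Proof.
apply: comm_mx_stable_eigenspace.
by rewrite /comm_mx -!trmx_mul kron_sym_comm.
Qed.

Lemma skew_space_stable A B : stablemx skew_space (kron_sym A B)^T.
Proof.
apply: comm_mx_stable_eigenspace.
by rewrite /comm_mx -!trmx_mul kron_sym_comm.
Qed.

End Facts.

Lemma eigenvalues_on_unique (R : realType) (m : nat) (V M : 'M[R]_m)
    (l1 l2 : seq R) :
  eigenvalues_on V M l1 -> eigenvalues_on V M l2 -> l1 = l2.
Proof.
move=> [s1 e1] [s2 e2]; apply: (sorted_eq (leT := >=%R)) => //.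
- by move=> y x z /= xy yz; apply: le_trans yz xy.
- by move=> x y /= /andP[xy yx]; apply/le_anti/andP.
- by apply: prod_XsubC_eq; rewrite -e1 -e2.
Qed.

(* Main.v *)
Require Import Defs.
From mathcomp Require Import all_boot all_order all_algebra.
From mathcomp Require Import reals.
From mathcomp Require Import fingroup perm complex mxtens polyrcf ring lra zify.
From mathcomp Require Import boolp classical_sets.

Set Implicit Arguments.
Unset Strict Implicit.
Unset Printing Implicit Defensive.

Import Order.TTheory GRing.Theory Num.Theory.

Local Open Scope ring_scope.

(* A symmetric X and a skew-symmetric W are compared through the quadratic form
   q(X) = tr (X^T A X B), half the form of A (x) B + B (x) A.  By Courant-Fischer
   it is enough to show, for i = 1, 2, 3: if q(W) >= mu |W|^2 on an i-dimensional
   space of skew W, then any i - 1 linear functionals have a common symmetric zero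
   X <> 0 with q(X) >= mu |X|^2 (for i = 3, if q(W) > mu |W|^2 whenever W <> 0); replacing A
   by - A gives the other inequalities.

   i = 1, 2.  Let W = u v^T - v u^T and let X be symmetric with range in <u, v>.
   If tr X = tr (X A) = 0, then X A X and X^2 are the same multiple of W^T A W and
   W^T W, so X and W have the same Rayleigh quotient.  For i = 2 the skew W are
   u v^T - v u^T with v fixed and u in a plane; requiring in addition that X is
   killed by the functional leaves three linear equations in three unknowns, whose
   determinant is a cubic form in u and hence has a real zero.

   i = 3.  Take A = diag (a1, a2, a3) with a2 = s^2 a1 + c^2 a3, c^2 + s^2 = 1, and
   let P be the positive definite form of q - mu |.|^2 on R^3 ~ skew matrices.  With
   p = (c, 0, s) the compression of A to the plane orthogonal to p is scalar, so on
   the trace-free symmetric matrices of that plane q - mu |.|^2 is a multiple of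
   P(p, p).  A third matrix x E12 + y E13 keeps the form nonnegative for an explicit
   (x, y), and two functionals have a common zero in this 3-dimensional space. *)

(** * Real symmetric matrices *)

Section Spectral.
Variable R : realType.

Lemma dotmx_ge0 n (v : 'rV[R]_n) : 0 <= (v *m v^T) 0 0.
Proof. by rewrite mxE sumr_ge0 // => i _; rewrite mxE -expr2 sqr_ge0. Qed.

Lemma dotmx_eq0 n (v : 'rV[R]_n) : ((v *m v^T) 0 0 == 0) = (v == 0).
Proof.
apply/idP/eqP => [|->]; last by rewrite mul0mx mxE.
rewrite mxE psumr_eq0 => [/allP h|i _]; last by rewrite mxE -expr2 sqr_ge0.
apply/rowP => i; have := h i (mem_index_enum _).
by rewrite !mxE /= -expr2 sqrf_eq0 => /eqP.
Qed.

Lemma trmx11 (X : 'M[R]_1) : X^T = X.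
Proof. by apply/matrixP => i j; rewrite mxE !ord1. Qed.

(** Take a complex eigenvector [x + i y] with eigenvalue [a + i b]. Symmetry of [M] gives
    [b (|x|^2 + |y|^2) = 0], so [b = 0], and [x] or [y] is a nonzero real eigenvector. *)
Lemma symmetric_eigenvector n (M : 'M[R]_n.+1) : M^T = M ->
  exists a (v : 'rV_n.+1), v != 0 /\ v *m M = a *: v.
Proof.
move=> sM; have [z] := eigenvalue_closed (map_mx (real_complex R) M) (ltn0Sn n).
case/eigenvalueP => w wM w0; case: z wM => a b wM.
pose x := map_mx (@complex.Re R) w; pose y := map_mx (@complex.Im R) w.
have wE i : w 0 i = (x 0 i +i* y 0 i)%C by rewrite !mxE; case: (w 0 i).
move: x y wE => x y wE.
have sumE (F G : 'I_n.+1 -> R) :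
    \sum_i (F i +i* G i)%C = ((\sum_i F i) +i* (\sum_i G i))%C.
  by elim/big_rec3: _ => //= i p q r _ ->.
have xyM i : (x *m M) 0 i = a * x 0 i - b * y 0 i /\
             (y *m M) 0 i = a * y 0 i + b * x 0 i.
  have : \sum_j w 0 j * (M j i)%:C%C = (a +i* b)%C * w 0 i.
    move/rowP/(_ i): wM; rewrite !mxE => <-.
    by apply: eq_bigr => j _; congr (_ * _); rewrite mxE.
  rewrite wE (eq_bigr (fun j => (x 0 j * M j i +i* (y 0 j * M j i))%C)).
    rewrite sumE [X in _ = X]/= => -[xi yi].
    by rewrite ![(_ *m _) 0 i]mxE xi yi; split; rewrite // addrC.
  by move=> j _; rewrite wE; apply/eqP; rewrite eq_complex /= !mulr0 subr0 add0r !eqxx.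
have xM : x *m M = a *: x - b *: y by apply/rowP => i; rewrite (xyM i).1 !mxE.
have yM : y *m M = a *: y + b *: x by apply/rowP => i; rewrite (xyM i).2 !mxE.
have sxy (p q : 'rV[R]_n.+1) : (p *m q^T) 0 0 = (q *m p^T) 0 0.
  by rewrite -[q *m _]trmx11 trmx_mul trmxK.
have : (x *m M *m y^T) 0 0 = (y *m M *m x^T) 0 0.
  by rewrite -[_ *m x^T]trmx11 !trmx_mul trmxK sM mulmxA.
have [bz | b0] := eqVneq b 0.
  rewrite bz !scale0r ?subr0 ?addr0 in xM yM => _.
  have [x0|x0] := eqVneq x 0; last by exists a, x.
  exists a, y; split=> //; apply: contra_neq w0 => y0; apply/rowP => i.
  by rewrite wE x0 y0 !mxE.
rewrite xM yM mulmxBl mulmxDl -!scalemxAl => h; case/negP: w0; apply/eqP.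
have e : (x *m x^T) 0 0 + (y *m y^T) 0 0 = 0.
  apply: (mulfI b0); move: h (sxy x y).
  move: (x *m x^T) (x *m y^T) (y *m x^T) (y *m y^T) => p q r s.
  by rewrite !mxE => + qr; rewrite qr; lra.
have x0 : x = 0.
  by apply/eqP; rewrite -dotmx_eq0; move: (dotmx_ge0 x) (dotmx_ge0 y) e; lra.
have y0 : y = 0.
  by apply/eqP; rewrite -dotmx_eq0; move: (dotmx_ge0 x) (dotmx_ge0 y) e; lra.
by apply/rowP => i; rewrite wE x0 y0 !mxE.
Qed.

Definition householder n (w : 'rV[R]_n) : 'M[R]_n :=
  1%:M - (2 / (w *m w^T) 0 0) *: (w^T *m w).

Lemma householder_orthogonal n (w : 'rV[R]_n) : w != 0 ->
  householder w *m (householder w)^T = 1%:M.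
Proof.
rewrite -dotmx_eq0 /householder; set k := (_ *m _) 0 0 => k0.
have KK : w^T *m w *m (w^T *m w) = k *: (w^T *m w).
  rewrite mulmxA -[w^T *m w *m w^T]mulmxA [w *m w^T]mx11_scalar -/k.
  by rewrite mul_mx_scalar scalemxAl.
rewrite [(_ - _)^T]linearB /= [(_ *: _)^T]linearZ /= trmx1 trmx_mul trmxK.
rewrite mulmxBl mul1mx mulmxBr mulmx1 -scalemxAl -scalemxAr KK !scalerA.
rewrite (_ : 2 / k * (2 / k) * k = 2 / k + 2 / k); last by field.
by rewrite scalerDl opprB addrK subrK.
Qed.

(** The reflection along [u - e] exchanges the unit vectors [e] and [u], so its first row is [u];
    only [u = e] is degenerate. *)
Lemma orthogonal_completion n (u : 'rV[R]_n.+1) : (u *m u^T) 0 0 = 1 ->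
  exists U : 'M[R]_n.+1, U *m U^T = 1%:M /\ row 0 U = u.
Proof.
move=> u1; pose e : 'rV[R]_n.+1 := delta_mx 0 0; pose w := u - e.
have [w0|w0] := eqVneq w 0.
  exists 1%:M; rewrite trmx1 mulmx1; split=> //.
  by rewrite row1; move/eqP: w0; rewrite subr_eq0 => /eqP ->.
exists (householder w); split; first exact: householder_orthogonal.
pose k := (w *m w^T) 0 0.
have k0 : k != 0 by rewrite dotmx_eq0.
have uu : u *m u^T = 1%:M by rewrite [LHS]mx11_scalar u1.
have ee : e *m e^T = 1%:M.
  by rewrite trmx_delta mul_delta_mx; apply/rowP => i; rewrite !ord1 !mxE.
have ewk : (e *m w^T) 0 0 = - (k / 2).
  have : k = - (2 * (e *m w^T) 0 0).
    have wT : w^T = u^T - e^T by rewrite /w linearB.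
    rewrite /k wT {1}/w mulmxBl !mulmxBr uu ee.
    have : (e *m u^T) 0 0 = (u *m e^T) 0 0.
      by rewrite -[u *m _]trmx11 trmx_mul trmxK.
    move: (e *m u^T) (u *m e^T) => p q; rewrite !mxE /= => ->; ring.
  by move=> h; lra.
rewrite rowE -/e /householder -/k mulmxBr mulmx1 -scalemxAr mulmxA.
rewrite [e *m w^T]mx11_scalar ewk.
rewrite mul_scalar_mx scalerA (_ : 2 / k * - (k / 2) = -1); last by field.
by rewrite scaleN1r opprK /w addrC subrK.
Qed.

(** Deflation: completing a unit eigenvector to an orthogonal matrix clears the first row and, by
    symmetry, the first column off the diagonal; induction treats the remaining block. *)
Lemma symmetric_diagonalization n (M : 'M[R]_n) : M^T = M ->
  exists (U : 'M[R]_n) (d : 'rV_n), U *m U^T = 1%:M /\ U *m M *m U^T = diag_mx d.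
Proof.
elim: n M => [|n IHn] M sM.
  by exists 1%:M, 0; split; apply/matrixP => -[].
have [a [v [v0 vM]]] := symmetric_eigenvector sM.
pose u := (Num.sqrt ((v *m v^T) 0 0))^-1 *: v.
have u1 : (u *m u^T) 0 0 = 1.
  rewrite /u linearZ /= -scalemxAl -scalemxAr scalerA mxE -invfM -expr2.
  by rewrite sqr_sqrtr ?dotmx_ge0 // mulVf // dotmx_eq0.
have uM : u *m M = a *: u by rewrite /u -scalemxAl vM !scalerA mulrC.
have [U [UU Uu]] := orthogonal_completion u1.
have [N defN] : exists N : 'M[R]_(1 + n), N = U *m M *m U^T by eexists.
have sN : N^T = N by rewrite defN !trmx_mul trmxK sM mulmxA.
have N0 : row 0 N = a *: delta_mx 0 0.
  by rewrite defN !row_mul Uu uM -scalemxAl -Uu -row_mul UU row1.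
have Nur : ursubmx N = 0.
  apply/rowP => j; have /rowP/(_ (rshift 1 j)) := N0.
  rewrite !mxE /= mulr0 => <-; congr (N _ _); exact/val_inj.
have Ndl : dlsubmx N = 0.
  by rewrite -[dlsubmx N]trmxK trmx_dlsub sN Nur trmx0.
have [V [d [VV VN]]] := IHn (drsubmx N)
  (etrans (trmx_drsub N) (congr1 (@drsubmx _ 1 n 1 n) sN)).
pose W : 'M[R]_(1 + n) := block_mx 1%:M 0 0 V.
have WW : W *m W^T = 1%:M.
  rewrite /W tr_block_mx mulmx_block !trmx0 trmx1 !mul0mx !mulmx0 mulmx1 VV.
  by rewrite addr0 !add0r -scalar_mx_block.
have WN : W *m N *m W^T = diag_mx (row_mx (ulsubmx N) d).
  rewrite -[N in LHS]submxK Nur Ndl /W tr_block_mx !mulmx_block trmx1 !trmx0.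
  rewrite !mul0mx !mulmx0 !mul1mx !mulmx1 !addr0 !add0r VN.
  rewrite ?mul0mx diag_mx_row; congr block_mx.
  by apply/matrixP => i j; rewrite !ord1 !mxE eqxx.
exists (W *m U), (row_mx (ulsubmx N) d); split.
  by rewrite trmx_mul mulmxA -[W *m U *m _]mulmxA UU mulmx1 WW.
rewrite trmx_mul !mulmxA -[W *m U *m M]mulmxA -[W *m (U *m M) *m _]mulmxA.
by rewrite -defN; exact: WN.
Qed.

End Spectral.

(** * Characteristic polynomials of restrictions to invariant subspaces *)

Section CharPoly.
Variable F : fieldType.

Lemma char_poly_conj n (D A : 'M[F]_n) : D \in unitmx ->
  char_poly (D *m A *m invmx D) = char_poly A.
Proof.
move=> uD; rewrite /char_poly /char_poly_mx.
have <- : map_mx polyC D *m ('X%:M - map_mx polyC A) *m map_mx polyC (invmx D)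
    = 'X%:M - map_mx polyC (D *m A *m invmx D).
  rewrite mulmxBr mulmxBl -!map_mxM mul_mx_scalar -scalemxAl -map_mxM mulmxV //.
  by rewrite map_mx1 scalemx1.
rewrite !det_mulmx mulrAC -det_mulmx -map_mxM mulmxV //.
by rewrite map_mx1 det1 mul1r.
Qed.

(** Two bases of one invariant space differ by an invertible [D], so the matrices of the restriction
    are similar. This trades the basis built into [restrictmx] for an orthonormal one. *)
Lemma char_poly_conjmx_eqmx m r1 r2 (G1 : 'M[F]_(r1, m)) (G2 : 'M[F]_(r2, m)) f :
  row_free G1 -> row_free G2 -> (G1 :=: G2)%MS -> stablemx G2 f ->
  char_poly (conjmx G1 f) = char_poly (conjmx G2 f).
Proof.
move=> f1 f2 e12 stf.
have e : r1 = r2 by rewrite -(eqP f1) -(eqP f2) e12.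
subst r2; have sub12 : (G1 <= G2)%MS by rewrite e12.
pose D := G1 *m pinvmx G2.
have D2 : G1 = D *m G2 by rewrite mulmxKpV.
have uD : D \in unitmx.
  rewrite -row_full_unit -col_leq_rank -{1}(eqP f1) {1}D2 mxrankM_maxl //.
by rewrite D2 conjuMmx // conjumx // char_poly_conj.
Qed.

Lemma conjmx_intertwine m r (G : 'M[F]_(r, m)) (f : 'M_m) (N : 'M_r) :
  row_free G -> G *m f = N *m G -> conjmx G f = N.
Proof. by move=> fG e; rewrite /conjmx e mulmxKp. Qed.

End CharPoly.

(** * Orthogonal diagonalization with sorted eigenvalues *)

Section Sorted.
Variable R : realType.

Lemma sorted_diagonalization n (M : 'M[R]_n) : M^T = M ->
  exists (U : 'M[R]_n) (l : n.-tuple R),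
    [/\ sorted >=%R l, U *m U^T = 1%:M
      & M = U^T *m diag_mx (\row_i tnth l i) *m U].
Proof.
move=> sM; have [U [d [UU UM]]] := symmetric_diagonalization sM.
pose t := [tuple d 0 i | i < n].
have /tuple_permP [p pE] : perm_eq (sort >=%R t) t by rewrite perm_sort.
have st : sorted >=%R (sort >=%R t).
  by apply: sort_sorted => x y; apply: real_leVge; rewrite num_real.
exists (row_perm p U), [tuple tnth t (p i) | i < n]; rewrite -pE.
have VV : row_perm p U *m (row_perm p U)^T = 1%:M.
  rewrite row_permE trmx_mul mulmxA -[_ *m U *m _]mulmxA UU mulmx1.
  by rewrite tr_perm_mx -perm_mxM mulgV perm_mx1.
split=> //; set V := row_perm p U.
have VM : V *m M *m V^T = diag_mx (\row_i tnth [tuple tnth t (p i) | i < n] i).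
  rewrite /V row_permE trmx_mul !mulmxA -[_ *m U *m M]mulmxA.
  rewrite -[_ *m (U *m M) *m _]mulmxA UM tr_perm_mx -row_permE -col_permE.
  by apply/matrixP => i j; rewrite !mxE !tnth_mktuple (inj_eq perm_inj).
have VV' : V^T *m V = 1%:M by apply: mulmx1C.
by rewrite -VM !mulmxA VV' mul1mx -mulmxA VV' mulmx1.
Qed.

Lemma char_poly_diagonalized n (U : 'M[R]_n) (l : n.-tuple R) : U *m U^T = 1%:M ->
  char_poly (U^T *m diag_mx (\row_i tnth l i) *m U) = \prod_(x <- l) ('X - x%:P).
Proof.
move=> UU; have [_ uU] := mulmx1_unit UU.
have e : invmx U^T = U.
  by rewrite -[LHS]mul1mx -UU -mulmxA mulmxV // mulmx1.
rewrite -{2}e char_poly_conj // char_poly_trig ?diag_mx_is_trig //.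
by rewrite big_tuple; apply: eq_bigr => i _; rewrite !mxE eqxx.
Qed.

Lemma quadratic_diagonalized n (U : 'M[R]_n) (l x : 'rV_n) :
  (x *m (U^T *m diag_mx l *m U) *m x^T) 0 0 =
  \sum_i l 0 i * (x *m U^T) 0 i ^+ 2.
Proof.
rewrite !mulmxA -[_ *m U *m _]mulmxA -[U *m x^T]trmxK trmx_mul trmxK mul_mx_diag.
by rewrite mxE; apply: eq_bigr => i _; rewrite mxE [X in _ * X]mxE; ring.
Qed.

Lemma dotmx_orthogonal n (U : 'M[R]_n) (x : 'rV_n) : U *m U^T = 1%:M ->
  (x *m x^T) 0 0 = \sum_i (x *m U^T) 0 i ^+ 2.
Proof.
move=> UU; have UU' : U^T *m U = 1%:M by apply: mulmx1C.
have -> : x *m x^T = (x *m U^T) *m (x *m U^T)^T.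
  by rewrite trmx_mul trmxK mulmxA -[x *m U^T *m U]mulmxA UU' mulmx1.
by rewrite mxE; apply: eq_bigr => i _; rewrite [X in _ * X]mxE expr2.
Qed.

End Sorted.
(** * Symmetric and skew matrices supported on a plane *)

Section Plane.
Variable R : realType.

Definition sym2 (x y z : R) : 'M[R]_2 :=
  \matrix_(i, j) (if i == j then if i == 0 then x else z else y).

(** Congruence by this matrix sends a symmetric [G] to its adjugate. *)
Definition alt2 : 'M[R]_2 :=
  \matrix_(i, j) (if i == j then 0 else if i == 0 then 1 else -1).

(* By Cayley-Hamilton, tr (S G) = 0 gives S G S = - det S * adj G. *)
Lemma sym2_traceless (G : 'M[R]_2) x y z : G^T = G ->
  \tr (sym2 x y z *m G) = 0 ->
  sym2 x y z *m G *m sym2 x y z =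
  (y ^+ 2 - x * z) *: (alt2^T *m G *m alt2).
Proof.
move=> /matrixP sG; have := sG 0 1; rewrite !mxE => G10.
rewrite /mxtrace !big_ord_recl big_ord0 !mxE !big_ord_recl !big_ord0 !mxE /=.
move: G10; rewrite (_ : lift ord0 ord0 = 1 :> 'I_2); last exact/val_inj.
rewrite (_ : ord0 = 0 :> 'I_2); last exact/val_inj.
move=> G10 tr0; have e : x * G 0 0 = - (2 * y * G 0 1 + z * G 1 1).
  by move: tr0; rewrite G10; lra.
apply/matrixP => i j; rewrite !mxE !big_ord_recl !big_ord0 !mxE /=.
rewrite !big_ord_recl !big_ord0 !mxE /=.
rewrite (_ : lift ord0 ord0 = 1 :> 'I_2); last exact/val_inj.
rewrite (_ : ord0 = 0 :> 'I_2); last exact/val_inj.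
case: i => [[|[|//]] i2]; case: j => [[|[|//]] j2] /=; rewrite ?G10.
all: ring: e.
Qed.

Lemma plane_congruence n (A : 'M[R]_n) (F : 'M_(n, 2)) x y z : A^T = A ->
  \tr (sym2 x y z *m (F^T *m A *m F)) = 0 ->
  (F *m sym2 x y z *m F^T) *m A *m (F *m sym2 x y z *m F^T) =
  (y ^+ 2 - x * z) *: ((F *m alt2 *m F^T)^T *m A *m (F *m alt2 *m F^T)).
Proof.
move=> sA tr0; have sG : (F^T *m A *m F)^T = F^T *m A *m F.
  by rewrite !trmx_mul trmxK sA mulmxA.
have := sym2_traceless sG tr0; set S := sym2 x y z => e.
have -> : F *m S *m F^T *m A *m (F *m S *m F^T)
    = F *m (S *m (F^T *m A *m F) *m S) *m F^T by rewrite !mulmxA.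
by rewrite e -scalemxAr -scalemxAl !trmx_mul trmxK !mulmxA.
Qed.

Lemma trmx_sym2 x y z : (sym2 x y z)^T = sym2 x y z.
Proof. by apply/matrixP => -[[|[|//]] i] [[|[|//]] j]; rewrite !mxE. Qed.

Lemma mxtrace_trmx_mul m n (X Y : 'M[R]_(m, n)) :
  \tr (X^T *m Y) = \sum_i \sum_j X i j * Y i j.
Proof.
rewrite /mxtrace exchange_big /=; apply: eq_bigr => j _.
by rewrite mxE; apply: eq_bigr => i _; rewrite mxE.
Qed.

Lemma mxnorm_ge0 m n (X : 'M[R]_(m, n)) : 0 <= \tr (X^T *m X).
Proof.
rewrite mxtrace_trmx_mul sumr_ge0 // => i _; apply: sumr_ge0 => j _.
by rewrite -expr2 sqr_ge0.
Qed.

Lemma mxnorm_eq0 m n (X : 'M[R]_(m, n)) : (\tr (X^T *m X) == 0) = (X == 0).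
Proof.
apply/idP/eqP => [|->]; last by rewrite mulmx0 mxtrace0.
rewrite mxtrace_trmx_mul psumr_eq0 => [/allP h|i _]; last first.
  by apply: sumr_ge0 => j _; rewrite -expr2 sqr_ge0.
apply/matrixP => i j; have /eqP/eqP := h i (mem_index_enum _).
rewrite psumr_eq0 => [/allP h'|j' _]; last by rewrite -expr2 sqr_ge0.
by have := h' j (mem_index_enum _); rewrite mxE /= -expr2 sqrf_eq0 => /eqP.
Qed.

Lemma mxnorm_gt0 m n (X : 'M[R]_(m, n)) : (0 < \tr (X^T *m X)) = (X != 0).
Proof. by rewrite lt_def mxnorm_eq0 mxnorm_ge0 andbT. Qed.

(** By the congruence for [A] and for the identity, [X A X] and [X^2] are the multiples of [W^T A W]
    and [W^T W] by the same scalar [y^2 - x z], which is nonnegative because [|X|^2 >= 0] and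
    [|W|^2 > 0]. *)
Lemma plane_bound n (A B : 'M[R]_n) (F : 'M_(n, 2)) x y z mu : A^T = A ->
  let X := F *m sym2 x y z *m F^T in let W := F *m alt2 *m F^T in
  \tr (sym2 x y z *m (F^T *m A *m F)) = 0 ->
  \tr (sym2 x y z *m (F^T *m F)) = 0 ->
  W != 0 ->
  mu * \tr (W^T *m W) <= \tr (W^T *m A *m W *m B) ->
  mu * \tr (X^T *m X) <= \tr (X^T *m A *m X *m B).
Proof.
move=> sA X W trA tr1 W0.
have sX : X^T = X by rewrite /X !trmx_mul trmxK trmx_sym2 mulmxA.
have := @plane_congruence n 1%:M F x y z (trmx1 _ _).
rewrite !mulmx1 => /(_ tr1); rewrite -/X -/W => XX.
have := plane_congruence sA trA; rewrite -/X -/W => XAX.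
rewrite sX XAX XX -scalemxAl !mxtraceZ mulrCA => h.
apply: ler_wpM2l h.
have : 0 <= \tr (X^T *m X) by exact: mxnorm_ge0.
by rewrite sX XX mxtraceZ pmulr_lge0 // mxnorm_gt0.
Qed.

Lemma det_mx33 (f : nat -> nat -> R) :
  \det (\matrix_(i < 3, j < 3) f i j) =
    f 0%N 0%N * (f 1%N 1%N * f 2%N 2%N - f 1%N 2%N * f 2%N 1%N)
  - f 0%N 1%N * (f 1%N 0%N * f 2%N 2%N - f 1%N 2%N * f 2%N 0%N)
  + f 0%N 2%N * (f 1%N 0%N * f 2%N 1%N - f 1%N 1%N * f 2%N 0%N).
Proof.
rewrite (expand_det_row _ ord0) !big_ord_recl big_ord0 /cofactor.
rewrite !(expand_det_row _ ord0) !big_ord_recl !big_ord0 /cofactor !det_mx11.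
by rewrite !mxE /= /bump /=; ring.
Qed.

(** If [d3] is nonzero, setting [c1 = 1] leaves a polynomial of odd degree in [c2]; otherwise
    [(0, 1)] is a zero. *)
Lemma cubic_form_root (d0 d1 d2 d3 : R) : exists c1 c2, (c1, c2) != (0, 0) /\
  d0 * c1 ^+ 3 + d1 * c1 ^+ 2 * c2 + d2 * c1 * c2 ^+ 2 + d3 * c2 ^+ 3 = 0.
Proof.
have [->|d3n0] := eqVneq d3 0.
  by exists 0, 1; split; [rewrite xpair_eqE oner_eq0 andbF|ring].
have [|t] := @odd_poly_root _ (Poly [:: d0; d1; d2; d3]).
  by rewrite (PolyK (c := 0)).
rewrite /root horner_Poly /= => /eqP e; exists 1, t.
by split; [rewrite xpair_eqE oner_eq0|rewrite -[RHS]e; ring].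
Qed.

Lemma singular3_kernel (a b c : nat -> R) :
  a 0%N * (b 1%N * c 2%N - c 1%N * b 2%N) - b 0%N * (a 1%N * c 2%N - c 1%N * a 2%N)
    + c 0%N * (a 1%N * b 2%N - b 1%N * a 2%N) = 0 ->
  exists x y z, (x, y, z) != (0, 0, 0) /\
    forall i, (i < 3)%N -> x * a i + y * b i + z * c i = 0.
Proof.
move=> d0; pose f i j := nth 0 [:: a j; b j; c j] i.
have /eqP/det0P[v v0 vM] : \det (\matrix_(i < 3, j < 3) f i j) = 0.
  by rewrite det_mx33 /f /= -[RHS]d0; ring.
exists (v 0 ord0), (v 0 (lift ord0 ord0)), (v 0 (lift ord0 (lift ord0 ord0))).
split.
  apply: contra_neq v0 => -[e0 e1 e2]; apply/rowP => i; rewrite mxE.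
  case: i => [[|[|[|//]]] i3]; [rewrite -[RHS]e0|rewrite -[RHS]e1|rewrite -[RHS]e2];
    congr (v _ _); exact/val_inj.
move=> i i3; have /rowP/(_ (Ordinal i3)) := vM.
by rewrite !mxE !big_ord_recl big_ord0 !mxE /= => e; rewrite -[RHS]e /f /=; ring.
Qed.

(** The determinant of three columns that are quadratic, linear and constant in [(c1, c2)] is a
    cubic form, expanded by multilinearity of [D]. At a real zero of it the columns are
    dependent. *)
Lemma quadratic_pencil (p q r s t k : nat -> R) :
  exists c1 c2 x y z, [/\ (c1, c2) != (0, 0), (x, y, z) != (0, 0, 0) &
    forall i, (i < 3)%N -> x * (c1 ^+ 2 * p i + 2 * c1 * c2 * q i + c2 ^+ 2 * r i)
      + y * (c1 * s i + c2 * t i) + z * k i = 0].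
Proof.
pose D (a b c : nat -> R) :=
  a 0%N * (b 1%N * c 2%N - c 1%N * b 2%N) - b 0%N * (a 1%N * c 2%N - c 1%N * a 2%N)
    + c 0%N * (a 1%N * b 2%N - b 1%N * a 2%N).
have [c1 [c2 [c0 e]]] := cubic_form_root (D p s k) (2 * D q s k + D p t k)
  (2 * D q t k + D r s k) (D r t k).
have [|x [y [z [xyz0 h]]]] := @singular3_kernel
  (fun i => c1 ^+ 2 * p i + 2 * c1 * c2 * q i + c2 ^+ 2 * r i)
  (fun i => c1 * s i + c2 * t i) k.
  by rewrite -[RHS]e /D; ring.
by exists c1, c2, x, y, z.
Qed.

Definition frame n (u v : 'cV[R]_n) : 'M[R]_(n, 2) :=
  \matrix_(i, j) (if j == 0 then u i 0 else v i 0).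

Lemma frame_form n (A : 'M[R]_n) (u v : 'cV[R]_n) :
  (frame u v)^T *m A *m frame u v =
  \matrix_(i, j) ((if i == 0 then u else v)^T *m A *m (if j == 0 then u else v)) 0 0.
Proof.
apply/matrixP => i j; rewrite mxE [RHS]mxE mxE; apply: eq_bigr => l _.
rewrite !mxE; case: (j == 0); congr (_ * _); apply: eq_bigr => h _;
  by rewrite !mxE; case: (i == 0).
Qed.

Lemma mxtrace_sym2 (f : 'I_2 -> 'I_2 -> R) x y z :
  \tr (sym2 x y z *m \matrix_(i, j) f i j) =
  x * f 0 0 + y * (f 0 1 + f 1 0) + z * f 1 1.
Proof.
rewrite /mxtrace !big_ord_recl big_ord0 !mxE !big_ord_recl !big_ord0 !mxE /=.
rewrite (_ : lift ord0 ord0 = 1 :> 'I_2); last exact/val_inj.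
rewrite (_ : ord0 = 0 :> 'I_2); last exact/val_inj.
by ring.
Qed.

Lemma mxtrace_sym2_frame n (A : 'M[R]_n) (u v : 'cV[R]_n) x y z : A^T = A ->
  \tr (sym2 x y z *m ((frame u v)^T *m A *m frame u v)) =
  x * (u^T *m A *m u) 0 0 + y * (2 * (u^T *m A *m v) 0 0) + z * (v^T *m A *m v) 0 0.
Proof.
move=> sA; rewrite frame_form mxtrace_sym2 /=.
have -> : (v^T *m A *m u) 0 0 = (u^T *m A *m v) 0 0.
  by rewrite -[v^T *m A *m u]trmx11 !trmx_mul trmxK sA mulmxA.
by ring.
Qed.

Lemma frame_alt2 n (u v : 'cV[R]_n) :
  frame u v *m alt2 *m (frame u v)^T = u *m v^T - v *m u^T.
Proof.
apply/matrixP => i j; rewrite !mxE !big_ord_recl !big_ord0 !mxE.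
by rewrite !big_ord_recl !big_ord0 !mxE /=; ring.
Qed.

(** Multiplying by [F^T] on the left and by [F] on the right puts [S] between two invertible Gram
    matrices. *)
Lemma mulmx_gram_eq0 n (F : 'M[R]_(n, 2)) S : F^T *m F \in unitmx ->
  F *m S *m F^T = 0 -> S = 0.
Proof.
move=> uD FSF; have : (F^T *m F) *m S *m (F^T *m F) = 0.
  transitivity (F^T *m (F *m S *m F^T) *m F); first by rewrite !mulmxA.
  by rewrite FSF mulmx0 mul0mx.
move/(congr1 (mulmx (invmx (F^T *m F)))); rewrite mulmx0 -mulmxA mulKmx //.
by move/(congr1 (mulmxr (invmx (F^T *m F)))); rewrite /= mulmxK // mul0mx.
Qed.

Lemma mulmx_gram_neq0 n (F : 'M[R]_(n, 2)) S : F^T *m F \in unitmx ->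
  S != 0 -> F *m S *m F^T != 0.
Proof. by move=> uD; apply: contra_neq; exact: mulmx_gram_eq0. Qed.

Lemma sym2_eq0 x y z : sym2 x y z = 0 -> (x, y, z) = (0, 0, 0).
Proof.
by move=> /matrixP e; have := (e 0 0, e 0 1, e 1 1); rewrite !mxE /= => -[[-> ->] ->].
Qed.

Lemma alt2_neq0 : alt2 != 0.
Proof.
by apply/eqP => /matrixP/(_ 0 1)/eqP; rewrite !mxE /= oner_eq0.
Qed.

Lemma frame_gram_unit n (u v : 'cV[R]_n) : u != 0 -> v != 0 ->
  (u^T *m v) 0 0 = 0 -> (frame u v)^T *m frame u v \in unitmx.
Proof.
move=> u0 v0 uv; have vu : (v^T *m u) 0 0 = 0.
  by rewrite -[v^T *m u]trmx11 trmx_mul trmxK.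
have -> : (frame u v)^T *m frame u v =
    diag_mx (\row_j if j == 0 then (u^T *m u) 0 0 else (v^T *m v) 0 0).
  rewrite -[(frame u v)^T]mulmx1 frame_form; apply/matrixP => i j.
  rewrite [LHS]mxE [RHS]mxE [(\row_ _ _) 0 _]mxE mulmx1.
  by case: i j => [[|[|//]] i] [[|[|//]] j] /=; rewrite ?mulr1n ?mulr0n.
have dot_neq0 (w : 'cV[R]_n) : w != 0 -> (w^T *m w) 0 0 != 0.
  move=> w0; have := dotmx_eq0 w^T; rewrite trmxK => ->.
  by rewrite -trmx0 (inj_eq trmx_inj).
rewrite unitmxE det_diag !big_ord_recl big_ord0 ![(\row_ _ _) _ _]mxE /= mulr1.
by rewrite unitfE mulf_neq0 ?dot_neq0.
Qed.

(** The two-dimensional case: [u] in the plane of [v1] and [v2] is chosen so that the three linear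
    conditions on [(x, y, z)] become dependent. *)
Lemma symmetric_plane_bound n (A B L : 'M[R]_n) (v1 v2 v3 : 'cV_n) mu :
  A^T = A -> (forall c1 c2, (c1, c2) != (0, 0) -> c1 *: v1 + c2 *: v2 != 0) ->
  (v1^T *m v3) 0 0 = 0 -> (v2^T *m v3) 0 0 = 0 -> v3 != 0 ->
  (forall c1 c2, let u := c1 *: v1 + c2 *: v2 in
    let W := u *m v3^T - v3 *m u^T in
    mu * \tr (W^T *m W) <= \tr (W^T *m A *m W *m B)) ->
  exists X, [/\ X^T = X, X != 0, \tr (X^T *m L) = 0 &
    mu * \tr (X^T *m X) <= \tr (X^T *m A *m X *m B)].
Proof.
move=> sA free v13 v23 v30 hW.
(* A symmetric [X] has the same trace against [L] and [L^T], so [L] may be symmetrized; all three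
   conditions then come from symmetric matrices. *)
pose M i := nth 0 [:: A; 1%:M; L + L^T] i.
have sM i : (i < 3)%N -> (M i)^T = M i.
  by case: i => [|[|[|]]] //= _; rewrite ?trmx1 // linearD /= trmxK addrC.
pose b i (p q : 'cV_n) := (p^T *m M i *m q) 0 0.
(* For [u = c1 v1 + c2 v2] the coefficients of [x], [y], [z] are [b(u, u)], [2 b(u, v3)] and
   [b(v3, v3)]. *)
have [c1 [c2 [x [y [z [c0 xyz0 h]]]]]] := quadratic_pencil
  (fun i => b i v1 v1) (fun i => b i v1 v2) (fun i => b i v2 v2)
  (fun i => 2 * b i v1 v3) (fun i => 2 * b i v2 v3) (fun i => b i v3 v3).
pose u := c1 *: v1 + c2 *: v2.
have uT : u^T = c1 *: v1^T + c2 *: v2^T by apply/matrixP => ? ?; rewrite !mxE.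
pose F := frame u v3; pose S := sym2 x y z.
have trM i : (i < 3)%N -> \tr (S *m (F^T *m M i *m F)) = 0.
  move=> i3; rewrite mxtrace_sym2_frame ?sM // -[RHS](h i i3).
  have b21 : (v2^T *m M i *m v1) 0 0 = (v1^T *m M i *m v2) 0 0.
    by rewrite -[v2^T *m M i *m v1]trmx11 !trmx_mul trmxK sM // mulmxA.
  rewrite /b uT /u !(mulmxDl, mulmxDr) -!(scalemxAl, scalemxAr).
  move: b21; move: (v2^T *m M i *m v1) (v1^T *m M i *m v2) (v1^T *m M i *m v1).
  move: (v2^T *m M i *m v2) (v1^T *m M i *m v3) (v2^T *m M i *m v3) => m1 m2 m3 m4 m5 m6.
  by rewrite !mxE => ->; ring.
have uD : F^T *m F \in unitmx.
  apply: frame_gram_unit => //; first exact: free.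
  rewrite uT mulmxDl -!scalemxAl.
  move: v13 v23; move: (v1^T *m v3) (v2^T *m v3) => m1 m2.
  by rewrite !mxE => -> ->; rewrite !mulr0 addr0.
have S0 : S != 0 by apply: contra_neq xyz0; exact: sym2_eq0.
have sX : (F *m S *m F^T)^T = F *m S *m F^T.
  by rewrite !trmx_mul trmxK trmx_sym2 mulmxA.
exists (F *m S *m F^T); split=> //.
- exact: mulmx_gram_neq0.
- have := trM 2%N isT; rewrite /M /= mulmxDr mulmxDl mulmxDr mxtraceD.
  have -> : \tr (S *m (F^T *m L^T *m F)) = \tr (S *m (F^T *m L *m F)).
    rewrite -[LHS]mxtrace_tr mxtrace_mulC !trmx_mul !trmxK trmx_sym2.
    by rewrite mxtrace_mulC -/S mxtrace_mulC !mulmxA.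
  rewrite -mulr2n => /eqP; rewrite mulrn_eq0 /= => /eqP <-.
  by rewrite sX -!mulmxA mxtrace_mulC !mulmxA.
- apply: plane_bound => //; first exact: (trM 0%N).
  + by have := trM 1%N isT; rewrite /M /= mulmx1.
  + by apply: mulmx_gram_neq0 alt2_neq0.
  by rewrite frame_alt2; exact: hW.
Qed.

Lemma symmetric_line_bound n (A B : 'M[R]_n) (u v : 'cV_n) mu :
  A^T = A -> u != 0 -> v != 0 -> (u^T *m v) 0 0 = 0 ->
  (let W := u *m v^T - v *m u^T in
    mu * \tr (W^T *m W) <= \tr (W^T *m A *m W *m B)) ->
  exists X, [/\ X^T = X, X != 0 &
    mu * \tr (X^T *m X) <= \tr (X^T *m A *m X *m B)].
Proof.
move=> sA u0 v0 uv hW.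
pose b (M : 'M[R]_n) (p q : 'cV_n) := (p^T *m M *m q) 0 0.
(* Only two conditions are imposed: the third entry of each list is the default 0, so the
   determinant vanishes. *)
have [|x [y [z [xyz0 h]]]] := @singular3_kernel (fun i => nth 0 [:: b A u u; b 1%:M u u] i)
  (fun i => nth 0 [:: 2 * b A u v; 2 * b 1%:M u v] i)
  (fun i => nth 0 [:: b A v v; b 1%:M v v] i); first by rewrite /=; ring.
pose F := frame u v; pose S := sym2 x y z.
have uD : F^T *m F \in unitmx by exact: frame_gram_unit.
have S0 : S != 0 by apply: contra_neq xyz0; exact: sym2_eq0.
exists (F *m S *m F^T); split.
- by rewrite !trmx_mul trmxK trmx_sym2 mulmxA.
- exact: mulmx_gram_neq0.
apply: plane_bound => //.
- by rewrite mxtrace_sym2_frame //; exact: (h 0%N).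
- by have := h 1%N isT; rewrite -mxtrace_sym2_frame ?trmx1 // mulmx1.
- by apply: mulmx_gram_neq0 alt2_neq0.
by rewrite frame_alt2.
Qed.

End Plane.
(** * The three-dimensional estimate *)

Section ThirdDirection.
Variable R : realType.

(** [m] and [De] are a principal minor and the determinant of the Gram matrix with rows [(F, a, h)],
    [(a, D, k)], [(h, k, L)]. The left-hand side is [m] times the difference to be shown
    nonnegative; the second equation serves the case [A1 < 0]. *)
Lemma third_direction_identity (F D L a h k s : R) :
  let C := 1 - s ^+ 2 in
  let m := F * L - h ^+ 2 in
  let De := F * (D * L - k ^+ 2) - a * (a * L - k * h) + h * (a * k - D * h) in
  let x := C * s * D - h + s * L in let y := C * a in
  let A1 := F * C * (a - 2 * s * k) ^+ 2 + 4 * s * m * (s * L - h) in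
  let A2 := C * a ^+ 2 * (F - 4 * s * h + 4 * s ^+ 2 * L) in
  let B := - F * C * a * k + F * C * s * k ^+ 2 + m * (s * L - h)
           + C * a ^+ 2 * (h - s * L) in
  m * (F * (L * x ^+ 2 - 2 * k * x * y + D * y ^+ 2)
       - (x * h - y * (2 * s * k - a)) ^+ 2 - 4 * C * a ^+ 2 * (h - s * L) ^+ 2)
  = B ^+ 2 + C * De * ((A1 + A2) / 2 + s ^+ 2 * C * De)
  /\ A1 - A2 = 4 * s * B.
Proof. by move=> C m De x y A1 A2 B; split; rewrite /A1 /A2 /B /m /De /x /y /C; field. Qed.

(* The hypothesis is positivity of the Gram form of (p, e2, e3) for the header's P,
   and x, y are the coordinates of the third matrix multiplied by c.  When A1 < 0,
   multiplying the identity by 4 s^2 exhibits its right-hand side as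
   ((A1 + A2) / 2 + 2 s^2 C De)^2 - A1 A2. *)
Lemma third_direction_gram (F D L a h k s c : R) : c != 0 -> c ^+ 2 = 1 - s ^+ 2 ->
  (forall x y z, (x, y, z) != (0, 0, 0) ->
    0 < F * x ^+ 2 + D * y ^+ 2 + L * z ^+ 2
        + 2 * a * x * y + 2 * h * x * z + 2 * k * y * z) ->
  forall C x y, C = 1 - s ^+ 2 -> x = C * s * D - h + s * L -> y = C * a ->
  (x * h - y * (2 * s * k - a)) ^+ 2 + 4 * C * a ^+ 2 * (h - s * L) ^+ 2 <=
  F * (L * x ^+ 2 - 2 * k * x * y + D * y ^+ 2).
Proof.
move=> c0 cs pd C x y defC defx defy.
have C0 : 0 < C by rewrite defC -cs exprn_even_gt0.
have F0 : 0 < F.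
  have := pd 1 0 0; rewrite xpair_eqE xpair_eqE oner_eq0 => /(_ isT).
  by rewrite !(mulr0, expr0n, expr1n, mulr1, addr0).
pose m := F * L - h ^+ 2.
have m0 : 0 < m.
  have := pd (- h) 0 F; rewrite !xpair_eqE (gt_eqF F0) andbF => /(_ isT).
  rewrite [X in 0 < X](_ : _ = F * m); last by rewrite /m; ring.
  by rewrite pmulr_rgt0.
pose De := F * (D * L - k ^+ 2) - a * (a * L - k * h) + h * (a * k - D * h).
have De0 : 0 < De.
  (* The test vector is the second row of the adjugate of the Gram matrix, where the form equals
     [De * m]. *)
  have := pd (h * k - a * L) m (a * h - F * k).
  rewrite !xpair_eqE (gt_eqF m0) andbF => /(_ isT).
  rewrite [X in 0 < X](_ : _ = De * m); last by rewrite /m /De; ring.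
  by rewrite pmulr_lgt0.
have G0 : 0 < F - 4 * s * h + 4 * s ^+ 2 * L.
  have := pd 1 0 (- (2 * s)); rewrite !xpair_eqE oner_eq0 => /(_ isT).
  by rewrite [X in 0 < X](_ : _ = F - 4 * s * h + 4 * s ^+ 2 * L); last ring.
pose A1 := F * C * (a - 2 * s * k) ^+ 2 + 4 * s * m * (s * L - h).
pose A2 := C * a ^+ 2 * (F - 4 * s * h + 4 * s ^+ 2 * L).
pose B := - F * C * a * k + F * C * s * k ^+ 2 + m * (s * L - h)
          + C * a ^+ 2 * (h - s * L).
have [e eB] := third_direction_identity F D L a h k s.
rewrite /= -defC -defx -defy -/m -/De -/A1 -/A2 -/B in e eB.
have A20 : 0 <= A2 by rewrite mulr_ge0 ?(ltW G0) // mulr_ge0 ?sqr_ge0 // ltW.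
rewrite -subr_ge0 opprD addrA -(pmulr_rge0 _ m0) e.
have [A10|A10] := leP 0 A1.
  apply: addr_ge0; first exact: sqr_ge0.
  apply: mulr_ge0; first by rewrite ltW // mulr_gt0.
  apply: addr_ge0; first exact: divr_ge0 (addr_ge0 A10 A20) (ler0n _ _).
  by rewrite -mulrA mulr_ge0 ?sqr_ge0 // ltW // mulr_gt0.
have s0 : s != 0.
  apply: contraTneq A10 => s0; rewrite -leNgt /A1 s0 !(mulr0, mul0r) addr0.
  by rewrite mulr_ge0 ?sqr_ge0 // ltW // mulr_gt0.
have s20 : 0 < 4 * s ^+ 2 by rewrite mulr_gt0 // exprn_even_gt0.
rewrite -(pmulr_rge0 _ s20).
rewrite [X in 0 <= X](_ : _ =
    ((A1 + A2) / 2 + 2 * s ^+ 2 * C * De) ^+ 2 + (- A1) * A2); last first.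
  rewrite (_ : A1 = A2 + 4 * s * B); last by rewrite -eB; ring.
  by field.
by rewrite addr_ge0 ?sqr_ge0 // mulr_ge0 // oppr_ge0 ltW.
Qed.

End ThirdDirection.

(** * Coordinates on 3 x 3 matrices and the estimate for diagonal [A] *)

Section Space.
Variable R : realType.

Definition sym3 (x11 x12 x13 x22 x23 x33 : R) : 'M[R]_3 :=
  \matrix_(i, j) nth 0 (nth [::]
    [:: [:: x11; x12; x13]; [:: x12; x22; x23]; [:: x13; x23; x33]] i) j.

(** The matrix of the cross product with [(w1, w2, w3)]. *)
Definition skew3 (w1 w2 w3 : R) : 'M[R]_3 :=
  \matrix_(i, j) nth 0 (nth [::]
    [:: [:: 0; - w3; w2]; [:: w3; 0; - w1]; [:: - w2; w1; 0]] i) j.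

Lemma sym3P (B : 'M[R]_3) : B^T = B ->
  exists x11 x12 x13 x22 x23 x33, B = sym3 x11 x12 x13 x22 x23 x33.
Proof.
move=> /matrixP sB; pose b i j := B (inord i) (inord j).
exists (b 0 0)%N, (b 0 1)%N, (b 0 2)%N, (b 1 1)%N, (b 1 2)%N, (b 2 2)%N.
have bE i j : B i j = b i j by rewrite /b !inord_val.
have bC i j : b i j = b j i by rewrite /b -sB mxE.
apply/matrixP => i j; rewrite mxE bE.
by case: i j => [[|[|[|//]]] i] [[|[|[|//]]] j] //=.
Qed.

Lemma trmx_sym3 x11 x12 x13 x22 x23 x33 :
  (sym3 x11 x12 x13 x22 x23 x33)^T = sym3 x11 x12 x13 x22 x23 x33.
Proof.
by apply/matrixP => -[[|[|[|//]]] i] [[|[|[|//]]] j]; rewrite !mxE.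
Qed.

Lemma mxtrace_sym3 x11 x12 x13 x22 x23 x33 b11 b12 b13 b22 b23 b33 :
  \tr (sym3 x11 x12 x13 x22 x23 x33 *m sym3 b11 b12 b13 b22 b23 b33) =
  x11 * b11 + x22 * b22 + x33 * b33 + 2 * (x12 * b12 + x13 * b13 + x23 * b23).
Proof. by rewrite /mxtrace !(mxE, big_ord_recl, big_ord0) /=; ring. Qed.

Lemma sym3_congruence_diag x11 x12 x13 x22 x23 x33 a1 a2 a3 :
  let X := sym3 x11 x12 x13 x22 x23 x33 in
  X^T *m sym3 a1 0 0 a2 0 a3 *m X =
  sym3 (a1 * x11 ^+ 2 + a2 * x12 ^+ 2 + a3 * x13 ^+ 2)
       (a1 * x11 * x12 + a2 * x12 * x22 + a3 * x13 * x23)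
       (a1 * x11 * x13 + a2 * x12 * x23 + a3 * x13 * x33)
       (a1 * x12 ^+ 2 + a2 * x22 ^+ 2 + a3 * x23 ^+ 2)
       (a1 * x12 * x13 + a2 * x22 * x23 + a3 * x23 * x33)
       (a1 * x13 ^+ 2 + a2 * x23 ^+ 2 + a3 * x33 ^+ 2).
Proof.
apply/matrixP => i j; rewrite /= !(mxE, big_ord_recl, big_ord0) /=.
by case: i j => [[|[|[|//]]] i] [[|[|[|//]]] j] /=; ring.
Qed.

Lemma skew3_congruence_diag w1 w2 w3 a1 a2 a3 :
  let W := skew3 w1 w2 w3 in
  W^T *m sym3 a1 0 0 a2 0 a3 *m W =
  sym3 (a2 * w3 ^+ 2 + a3 * w2 ^+ 2) (- (a3 * w1 * w2)) (- (a2 * w1 * w3))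
       (a1 * w3 ^+ 2 + a3 * w1 ^+ 2) (- (a1 * w2 * w3))
       (a1 * w2 ^+ 2 + a2 * w1 ^+ 2).
Proof.
apply/matrixP => i j; rewrite /= !(mxE, big_ord_recl, big_ord0) /=.
by case: i j => [[|[|[|//]]] i] [[|[|[|//]]] j] /=; ring.
Qed.

Lemma sym3_1 : sym3 1 0 0 1 0 1 = 1%:M.
Proof. by apply/matrixP => -[[|[|[|//]]] i] [[|[|[|//]]] j]; rewrite !mxE. Qed.

Lemma trmx_skew3 w1 w2 w3 : (skew3 w1 w2 w3)^T = - skew3 w1 w2 w3.
Proof.
by apply/matrixP => -[[|[|[|//]]] i] [[|[|[|//]]] j]; rewrite !mxE /= ?oppr0 ?opprK.
Qed.

Lemma sym3_norm x11 x12 x13 x22 x23 x33 : let X := sym3 x11 x12 x13 x22 x23 x33 in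
  \tr (X^T *m X) = x11 ^+ 2 + x22 ^+ 2 + x33 ^+ 2
                   + 2 * (x12 ^+ 2 + x13 ^+ 2 + x23 ^+ 2).
Proof.
rewrite /= -[_^T]mulmx1 -sym3_1 sym3_congruence_diag -[sym3 _ _ _ _ _ _]mulmx1.
by rewrite -sym3_1 mxtrace_sym3; ring.
Qed.

Lemma skew3_norm w1 w2 w3 : let W := skew3 w1 w2 w3 in
  \tr (W^T *m W) = 2 * (w1 ^+ 2 + w2 ^+ 2 + w3 ^+ 2).
Proof.
rewrite /= -[_^T]mulmx1 -sym3_1 skew3_congruence_diag -[sym3 _ _ _ _ _ _]mulmx1.
by rewrite -sym3_1 mxtrace_sym3; ring.
Qed.

Lemma skew3_eq0 w1 w2 w3 : skew3 w1 w2 w3 = 0 -> (w1, w2, w3) = (0, 0, 0).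
Proof.
move=> W0; have := skew3_norm w1 w2 w3; rewrite /= W0 mulmx0 mxtrace0 => e.
have e1 := sqr_ge0 w1; have e2 := sqr_ge0 w2; have e3 := sqr_ge0 w3.
have z1 : w1 = 0 by apply/eqP; rewrite -sqrf_eq0; apply/eqP; lra.
have z2 : w2 = 0 by apply/eqP; rewrite -sqrf_eq0; apply/eqP; lra.
have z3 : w3 = 0 by apply/eqP; rewrite -sqrf_eq0; apply/eqP; lra.
by rewrite z1 z2 z3.
Qed.

(** On [X = t1 Y1 + t2 Y2 + t3 Y3] the shifted form is [F (t1^2 + t2^2) + 2 t3 (b1 t1 + b2 t2) +
    t3^2 Q] with [F > 0], hence nonnegative as soon as [b1^2 + b2^2 <= F Q]. *)
Lemma diagonal_space_bound (a1 a2 a3 s c mu : R) (B L1 L2 : 'M[R]_3) :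
  let A := sym3 a1 0 0 a2 0 a3 in
  c != 0 -> c ^+ 2 = 1 - s ^+ 2 -> a2 = s ^+ 2 * a1 + c ^+ 2 * a3 -> B^T = B ->
  (forall W : 'M[R]_3, W^T = - W -> W != 0 ->
    mu * \tr (W^T *m W) < \tr (W^T *m A *m W *m B)) ->
  exists X, [/\ X^T = X, X != 0, \tr (X^T *m L1) = 0, \tr (X^T *m L2) = 0 &
    mu * \tr (X^T *m X) <= \tr (X^T *m A *m X *m B)].
Proof.
move=> A c0 cs a2E /sym3P[b11 [b12 [b13 [b22 [b23 [b33 ->]]]]]] hW.
(* tr (W^T A W B) - mu tr (W^T W) has matrix P in the coordinates of skew3. *)
pose P11 := a2 * b33 + a3 * b22 - 2 * mu; pose P22 := a1 * b33 + a3 * b11 - 2 * mu.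
pose P33 := a1 * b22 + a2 * b11 - 2 * mu.
pose P12 := - (a3 * b12); pose P13 := - (a2 * b13); pose P23 := - (a1 * b23).
have pd w1 w2 w3 : (w1, w2, w3) != (0, 0, 0) ->
    0 < P11 * w1 ^+ 2 + P22 * w2 ^+ 2 + P33 * w3 ^+ 2
        + 2 * P12 * w1 * w2 + 2 * P13 * w1 * w3 + 2 * P23 * w2 * w3.
  move=> w0; have := hW _ (trmx_skew3 w1 w2 w3) (contra_neq (@skew3_eq0 _ _ _) w0).
  rewrite skew3_norm skew3_congruence_diag mxtrace_sym3 -subr_gt0.
  by rewrite [X in 0 < X -> _](_ : _ = P11 * w1 ^+ 2 + P22 * w2 ^+ 2 + P33 * w3 ^+ 2
    + 2 * P12 * w1 * w2 + 2 * P13 * w1 * w3 + 2 * P23 * w2 * w3) //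
    /P11 /P22 /P33 /P12 /P13 /P23; ring.
pose F := c ^+ 2 * P11 + s ^+ 2 * P33 + 2 * c * s * P13.
pose Q (x y : R) := P33 * x ^+ 2 - 2 * P23 * x * y + P22 * y ^+ 2.
pose b1 (x y : R) := y * (s * P23 - c * P12) - x * (s * P33 + c * P13).
pose b2 (x y : R) := y * (P13 + c * s * P22) - x * (c ^+ 2 * P12 + c * s * P23).
have F0 : 0 < F.
  have /pd : (c, 0, s) != (0, 0, 0) :> R * R * R by rewrite !xpair_eqE (negbTE c0).
  by congr (0 < _); rewrite /F; ring.
have [x [y [xy0 hxy]]] : exists x y, (x, y) != (0, 0) /\
    b1 x y ^+ 2 + b2 x y ^+ 2 <= F * Q x y.
  pose a := c * P12 + s * P23; pose h := c * P13 + s * P33.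
  have pd' w1 w2 w3 : (w1, w2, w3) != (0, 0, 0) ->
      0 < F * w1 ^+ 2 + P22 * w2 ^+ 2 + P33 * w3 ^+ 2
          + 2 * a * w1 * w2 + 2 * h * w1 * w3 + 2 * P23 * w2 * w3.
    move=> w0; have /pd : (c * w1, w2, s * w1 + w3) != (0, 0, 0) :> R * R * R.
      apply: contra_neq w0 => -[/eqP + -> e]; rewrite mulf_eq0 (negbTE c0) /= => /eqP w1z.
      by move: e; rewrite w1z mulr0 add0r => ->.
    by congr (0 < _); rewrite /F /a /h; ring.
  pose x := c * s * P22 - P13; pose y := c * a.
  have [xy0|xy0] := eqVneq (x, y) (0, 0); last first.
    exists x, y; split=> //.
    have := third_direction_gram c0 cs pd' (erefl _) (erefl _) (erefl _).
    rewrite -cs => e; rewrite -(ler_pM2l (_ : 0 < c ^+ 2)) ?exprn_even_gt0 //.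
    by congr (_ <= _): e; rewrite /b1 /b2 /Q /x /y /h /a; ring.
  (* If the explicit pair is zero, then [b2] vanishes at [(1, 0)], and the claim reduces to
     positivity of the minor [F P33 - h^2]. *)
  exists 1, 0; split; first by rewrite xpair_eqE oner_eq0.
  have /pd' : (- h, 0, F) != (0, 0, 0) :> R * R * R.
    by rewrite !xpair_eqE (gt_eqF F0) andbF.
  rewrite [X in 0 < X -> _](_ : _ = F * (F * P33 - h ^+ 2)); last by ring.
  rewrite pmulr_rgt0 // subr_gt0 => /ltW; congr (_ <= _); last by rewrite /Q; ring.
  rewrite [b2 _ _](_ : _ = - y); last by rewrite /b2 /y /a; ring.
  by case: xy0 => _ ->; rewrite /b1 /h; ring.
(* Y1 and Y2 span the trace-free symmetric matrices killing (c, 0, s). *)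
pose Y1 := sym3 0 (- s) 0 0 c 0.
pose Y2 := sym3 (- s ^+ 2) 0 (c * s) 1 0 (- c ^+ 2).
pose Y3 := sym3 0 x y 0 0 0.
(* Two functionals give two equations in three unknowns; the default 0 supplies the trivial third
   one. *)
have [|t1 [t2 [t3 [t0 ht]]]] := @singular3_kernel _
  (fun i => nth 0 [:: \tr (Y1^T *m L1); \tr (Y1^T *m L2)] i)
  (fun i => nth 0 [:: \tr (Y2^T *m L1); \tr (Y2^T *m L2)] i)
  (fun i => nth 0 [:: \tr (Y3^T *m L1); \tr (Y3^T *m L2)] i); first by rewrite /=; ring.
pose X := t1 *: Y1 + t2 *: Y2 + t3 *: Y3.
have XE : X = sym3 (- (t2 * s ^+ 2)) (t3 * x - t1 * s) (t2 * (c * s) + t3 * y) t2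
                   (t1 * c) (- (t2 * c ^+ 2)).
  rewrite /X /Y1 /Y2 /Y3.
  by apply/matrixP => -[[|[|[|//]]] i] [[|[|[|//]]] j]; rewrite !mxE /=; ring.
have trL L : \tr (X^T *m L) =
    t1 * \tr (Y1^T *m L) + t2 * \tr (Y2^T *m L) + t3 * \tr (Y3^T *m L).
  rewrite /X !linearD /= !(linearZ _ _) /=.
  by rewrite !mulmxDl -!scalemxAl !mxtraceD !mxtraceZ.
exists X; split.
- by rewrite XE trmx_sym3.
- apply: contra_neq t0; rewrite XE => /matrixP X0.
  have t2z : t2 = 0 by have := X0 1 1; rewrite !mxE.
  have t1z : t1 = 0.
    by have /eqP := X0 1 2%:R; rewrite !mxE /= mulf_eq0 (negbTE c0) orbF => /eqP.
  have := X0 0 2%:R; have := X0 0 1; rewrite !mxE /= t1z t2z !mul0r subr0 add0r.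
  have [-> //|t3n0] := eqVneq t3 0.
  move=> /eqP + /eqP; rewrite !mulf_eq0 (negbTE t3n0) /= => /eqP xz /eqP yz.
  by move: xy0; rewrite xz yz eqxx.
- by rewrite trL; exact: (ht 0%N).
- by rewrite trL; exact: (ht 1%N).
rewrite XE sym3_norm sym3_congruence_diag mxtrace_sym3 -subr_ge0 -(pmulr_rge0 _ F0).
rewrite [X in 0 <= X](_ : _ = (F * t1 + t3 * b1 x y) ^+ 2 + (F * t2 + t3 * b2 x y) ^+ 2
  + t3 ^+ 2 * (F * Q x y - (b1 x y ^+ 2 + b2 x y ^+ 2))).
  by rewrite !addr_ge0 ?sqr_ge0 // mulr_ge0 ?sqr_ge0 // subr_ge0.
rewrite /F /Q /b1 /b2 /P11 /P22 /P33 /P12 /P13 /P23 a2E.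
by ring: cs.
Qed.

End Space.

(** * Reduction of the estimate to diagonal [A] *)

Section Rotated.
Variable R : realType.

(** [s^2] and [c^2] are the barycentric weights of [a2] between [a1] and [a3]; [c] is nonzero
    because [a1 > a2]. *)
Lemma middle_weights (a1 a2 a3 : R) : a1 > a2 -> a2 >= a3 ->
  exists s c, [/\ c != 0, c ^+ 2 = 1 - s ^+ 2 & a2 = s ^+ 2 * a1 + c ^+ 2 * a3].
Proof.
move=> a12 a23; have d0 : 0 < a1 - a3 by lra.
exists (Num.sqrt ((a2 - a3) / (a1 - a3))), (Num.sqrt ((a1 - a2) / (a1 - a3))).
have d1 : 0 < (a1 - a2) / (a1 - a3) by rewrite divr_gt0 // subr_gt0.
have d2 : 0 <= (a2 - a3) / (a1 - a3) by rewrite divr_ge0 ?subr_ge0 // ltW // -subr_gt0.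
rewrite !sqr_sqrtr // ?(ltW d1) //; split.
- by rewrite sqrtr_eq0 -ltNge.
- by field; rewrite gt_eqF.
- by field; rewrite gt_eqF.
Qed.

Lemma symmetric3_diagonalization (A : 'M[R]_3) : A^T = A ->
  exists V a1 a2 a3 s c, [/\ V *m V^T = 1%:M, A = V^T *m sym3 a1 0 0 a2 0 a3 *m V,
    c != 0, c ^+ 2 = 1 - s ^+ 2 & a2 = s ^+ 2 * a1 + c ^+ 2 * a3].
Proof.
move=> /sorted_diagonalization[U [l [sl UU AE]]].
pose a i := l`_i; have a01 : a 0%N >= a 1%N /\ a 1%N >= a 2.
  move: sl (size_tuple l); rewrite /a.
  by case: (tval l) => [|x [|y [|z []]]] //= /and3P[].
have DE : diag_mx (\row_i tnth l i) = sym3 (a 0%N) 0 0 (a 1%N) 0 (a 2).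
  apply/matrixP => -[[|[|[|//]]] i] [[|[|[|//]]] j];
    by rewrite !mxE ?(tnth_nth 0) //= ?mulr0n ?mulr1n.
rewrite DE in AE; case: a01 => a01 a12.
have [a1E|a1n] := eqVneq (a 0%N) (a 1%N); last first.
  have a10 : a 0%N > a 1%N by rewrite lt_def a1n.
  have [s [c [c0 cs aE]]] := middle_weights a10 a12.
  by exists U, (a 0%N), (a 1%N), (a 2), s, c.
(* If a1 = a2 the weights would force c = 0: reverse the order with J. *)
pose J : 'M[R]_3 := sym3 0 0 1 1 0 0.
have JJ : J *m J = 1%:M.
  apply/matrixP => i j; rewrite /J !(mxE, big_ord_recl, big_ord0).
  by case: i j => [[|[|[|//]]] i] [[|[|[|//]]] j] /=; ring.
have JT : J^T = J by rewrite trmx_sym3.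
exists (J *m U), (a 2), (a 1%N), (a 0%N), 0, 1; split.
- by rewrite trmx_mul JT mulmxA -[J *m U *m _]mulmxA UU mulmx1.
- have -> : sym3 (a 2) 0 0 (a 1%N) 0 (a 0%N) = J *m sym3 (a 0%N) 0 0 (a 1%N) 0 (a 2) *m J.
    apply/matrixP => i j; rewrite /J !(mxE, big_ord_recl, big_ord0).
    by case: i j => [[|[|[|//]]] i] [[|[|[|//]]] j] /=; ring.
  rewrite trmx_mul JT AE !mulmxA -[U^T *m J *m J]mulmxA JJ mulmx1.
  by rewrite -[_ *m J *m J]mulmxA JJ mulmx1.
- exact: oner_neq0.
- by rewrite expr0n subr0 expr1n.
- by rewrite a1E expr0n expr1n mul0r add0r mul1r.
Qed.

(** The rotation [X -> V^T X V] preserves symmetry, skewness and norm, and replaces [B], [L1], [L2]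
    by their conjugates under [V], so [A] may be taken diagonal. *)
Lemma symmetric_space_bound (A B L1 L2 : 'M[R]_3) mu : A^T = A -> B^T = B ->
  (forall W : 'M[R]_3, W^T = - W -> W != 0 ->
    mu * \tr (W^T *m W) < \tr (W^T *m A *m W *m B)) ->
  exists X, [/\ X^T = X, X != 0, \tr (X^T *m L1) = 0, \tr (X^T *m L2) = 0 &
    mu * \tr (X^T *m X) <= \tr (X^T *m A *m X *m B)].
Proof.
move=> /symmetric3_diagonalization[V [a1 [a2 [a3 [s [c [VV -> c0 cs a2E]]]]]]] sB hW.
set D := sym3 _ _ _ _ _ _ in hW *.
have VV' : V^T *m V = 1%:M by apply: mulmx1C.
have congE (X M N : 'M[R]_3) :
    \tr ((V^T *m X *m V)^T *m (V^T *m M *m V) *m (V^T *m X *m V) *m N) =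
    \tr (X^T *m M *m X *m (V *m N *m V^T)).
  rewrite !trmx_mul trmxK !mulmxA -[V^T *m X^T *m V *m V^T]mulmxA VV mulmx1.
  rewrite -[V^T *m X^T *m M *m V *m V^T]mulmxA VV mulmx1.
  by rewrite -!mulmxA mxtrace_mulC !mulmxA.
have normE (X N : 'M[R]_3) : \tr ((V^T *m X *m V)^T *m N) = \tr (X^T *m (V *m N *m V^T)).
  by rewrite !trmx_mul trmxK -!mulmxA mxtrace_mulC !mulmxA.
have nE (X : 'M[R]_3) : V *m (V^T *m X *m V) *m V^T = X.
  by rewrite !mulmxA VV mul1mx -mulmxA VV mulmx1.
have sB' : (V *m B *m V^T)^T = V *m B *m V^T by rewrite !trmx_mul trmxK sB mulmxA.
have [] := @diagonal_space_bound R a1 a2 a3 s c mu (V *m B *m V^T)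
  (V *m L1 *m V^T) (V *m L2 *m V^T) c0 cs a2E sB'.
  move=> W sW W0; have := hW (V^T *m W *m V).
  rewrite congE normE nE; apply.
    by rewrite !trmx_mul trmxK sW mulNmx mulmxN mulmxA.
  by apply: contra_neq W0 => W0; rewrite -[W]nE W0 mulmx0 mul0mx.
move=> X [sX X0 l1 l2 hX]; exists (V^T *m X *m V); split.
- by rewrite !trmx_mul trmxK sX mulmxA.
- by apply: contra_neq X0 => X0; rewrite -[X]nE X0 mulmx0 mul0mx.
- by rewrite normE.
- by rewrite normE.
- by rewrite congE normE nE.
Qed.

End Rotated.
(** * Comparison of the even and the odd spectrum *)

Section Comparison.
Variable R : realType.

(** For skew [W], the vector whose cross product [W] performs; it spans the kernel of [W] unless
    [W = 0]. *)
Definition axis (W : 'M[R]_3) : 'cV[R]_3 :=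
  \col_i nth 0 [:: W 2%:R 1; W 0 2%:R; W 1 0] i.

Lemma skew3P (W : 'M[R]_3) : W^T = - W ->
  exists w1 w2 w3, W = skew3 w1 w2 w3.
Proof.
move=> /matrixP sW.
have w i j : W i j = - W j i by have := sW j i; rewrite !mxE.
have w0 i : W i i = 0 by have := w i i; lra.
exists (W 2%:R 1), (W 0 2%:R), (W 1 0).
apply/matrixP => -[[|[|[|//]]] i] [[|[|[|//]]] j]; rewrite !mxE /= -?[in RHS]w;
  by [rewrite (bool_irrelevance j i) w0|congr (W _ _); exact/val_inj].
Qed.

Lemma axis_skew3 w1 w2 w3 :
  axis (skew3 w1 w2 w3) = \col_i nth 0 [:: w1; w2; w3] i.
Proof. by apply/colP => -[[|[|[|//]]] i]; rewrite !mxE. Qed.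

Lemma mul_skew_axis (W : 'M[R]_3) : W^T = - W -> W *m axis W = 0.
Proof.
move=> /skew3P[w1 [w2 [w3 ->]]]; rewrite axis_skew3; apply/colP => i.
rewrite !(mxE, big_ord_recl, big_ord0) /=.
by case: i => [[|[|[|//]]] i] /=; ring.
Qed.

Lemma dot_axis (W K : 'M[R]_3) : W^T = - W -> K^T = - K ->
  \tr (W^T *m K) = 2 * ((axis W)^T *m axis K) 0 0.
Proof.
move=> /skew3P[w1 [w2 [w3 ->]]] /skew3P[k1 [k2 [k3 ->]]]; rewrite !axis_skew3.
by rewrite mxtrace_trmx_mul !(mxE, big_ord_recl, big_ord0) /=; ring.
Qed.

(** An orthonormal eigenbasis of the class [Q], expressed through quadratic forms: Parseval's
    identity stands for spanning. The form is half that of [kron_sym A B], so the eigenvalues enter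
    later divided by 2. *)
Definition eigenframe (Q : 'M[R]_3 -> Prop) (A B : 'M[R]_3) n
    (l : 'I_n -> R) (L : 'I_n -> 'M[R]_3) :=
  [/\ forall i, Q (L i), forall i j, \tr ((L i)^T *m L j) = (i == j)%:R
    & forall X, Q X ->
      \tr (X^T *m A *m X *m B) = \sum_i l i * \tr (X^T *m L i) ^+ 2 /\
      \tr (X^T *m X) = \sum_i \tr (X^T *m L i) ^+ 2].

Lemma ord3_cases (i j k p : 'I_3) : i != j -> i != k -> j != k ->
  [|| p == i, p == j | p == k].
Proof.
by move: i j k p => [[|[|[|//]]] i] [[|[|[|//]]] j] [[|[|[|//]]] k] [[|[|[|//]]] p].
Qed.

Lemma weighted_sum_le (I : finType) (l y : I -> R) c :
  (forall i, y i != 0 -> l i <= c) -> \sum_i l i * y i ^+ 2 <= c * \sum_i y i ^+ 2.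
Proof.
move=> lc; rewrite mulr_sumr; apply: ler_sum => i _.
have [->|/lc] := eqVneq (y i) 0; first by rewrite expr0n !mulr0.
by apply: ler_wpM2r; exact: sqr_ge0.
Qed.

Lemma weighted_sum_ge (I : finType) (l y : I -> R) c :
  (forall i, y i != 0 -> c <= l i) -> c * \sum_i y i ^+ 2 <= \sum_i l i * y i ^+ 2.
Proof.
move=> lc; rewrite mulr_sumr; apply: ler_sum => i _.
have [->|/lc] := eqVneq (y i) 0; first by rewrite expr0n !mulr0.
by apply: ler_wpM2r; exact: sqr_ge0.
Qed.

Variables (A B : 'M[R]_3) (l : 'I_6 -> R) (L : 'I_6 -> 'M[R]_3).
Variables (b : 'I_3 -> R) (K : 'I_3 -> 'M[R]_3).
Hypotheses (sA : A^T = A) (sB : B^T = B).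
Hypothesis frameL : eigenframe (fun X => X^T = X) A B l L.
Hypothesis frameK : eigenframe (fun X => X^T = - X) A B b K.

(** The quotient of [X] is a weighted mean of those [l p] for which [X] has a nonzero
    coefficient. *)
Let le_bound X mu c : X^T = X -> X != 0 ->
  mu * \tr (X^T *m X) <= \tr (X^T *m A *m X *m B) ->
  (forall p, \tr (X^T *m L p) != 0 -> l p <= c) -> mu <= c.
Proof.
move=> sX X0 h lc; case: frameL => _ _ /(_ X sX)[fX nX].
rewrite -(ler_pM2r (_ : 0 < \tr (X^T *m X))) ?mxnorm_gt0 //.
by apply: le_trans h _; rewrite fX nX; exact: weighted_sum_le.
Qed.

Let axisK_dot i j : i != j -> ((axis (K i))^T *m axis (K j)) 0 0 = 0.
Proof.
case: frameK => skK oK _ ij; have := oK i j.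
by rewrite dot_axis // (negbTE ij) => /eqP; rewrite mulf_eq0 pnatr_eq0 /= => /eqP.
Qed.

Let axisK_norm i : ((axis (K i))^T *m axis (K i)) 0 0 = 2^-1.
Proof.
case: frameK => skK oK _; have := oK i i; rewrite dot_axis // eqxx => e.
by apply: (mulfI (_ : 2 != 0)); rewrite ?pnatr_eq0 // e divff ?pnatr_eq0.
Qed.

Let axisK_neq0 i : axis (K i) != 0.
Proof.
apply/eqP => e; have := axisK_norm i; rewrite e mulmx0 mxE => /eqP.
by rewrite eq_sym invr_eq0 pnatr_eq0.
Qed.

Let wedge (u v : 'cV[R]_3) := u *m v^T - v *m u^T.

Let wedge_skew u v : (wedge u v)^T = - wedge u v.
Proof. by rewrite /wedge linearB /= !trmx_mul !trmxK opprB. Qed.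

(** [K i] kills its axis from either side, so both terms of the trace vanish. *)
Let wedge_axis u v i : axis (K i) = u \/ axis (K i) = v ->
  \tr ((wedge u v)^T *m K i) = 0.
Proof.
case: frameK => skK _ _; have Ka := mul_skew_axis (skK i).
have aK : (axis (K i))^T *m K i = 0.
  by rewrite -[_ *m _]trmxK trmx_mul trmxK skK mulNmx Ka oppr0 trmx0.
have t1 p : \tr (axis (K i) *m p^T *m K i) = 0.
  by rewrite mxtrace_mulC mulmxA Ka mul0mx mxtrace0.
have t2 p : \tr (p *m (axis (K i))^T *m K i) = 0.
  by rewrite -mulmxA aK mulmx0 mxtrace0.
rewrite wedge_skew mulNmx /wedge mulmxBl raddfN raddfB /=.
by case=> <-; rewrite t1 t2 subrr oppr0.
Qed.

(** The wedge of the axes of [K j] and [K k] has no component along [K j] or [K k], so its quotient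
    is [b i]. *)
Lemma symmetric_top_ge i j k c : i != j -> i != k -> j != k ->
  (forall p, l p <= c) -> b i <= c.
Proof.
move=> ij ik jk lc; case: (frameK) => skK oK fK.
have [|X [sX X0 hX]] := symmetric_line_bound (mu := b i) (B := B) sA
  (axisK_neq0 j) (axisK_neq0 k) (axisK_dot jk).
  rewrite /= -/(wedge _ _); set W := wedge _ _.
  have [-> ->] := fK W (wedge_skew _ _).
  apply: weighted_sum_ge => p; have [->//|pi] := eqVneq p i.
  case/negP; apply/eqP; apply: wedge_axis.
  by case/or3P: (ord3_cases p ij ik jk) pi => /eqP-> pi; rewrite ?eqxx in pi; auto.
exact: le_bound hX _.
Qed.

(** Wedges of the axis of [K k] with the plane of the other two axes have no component along [K k],
    so their quotients are at least [b j]. The functional removes the coefficient of [X] along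
    [L p0]. *)
Lemma symmetric_second_ge i j k p0 c : i != j -> i != k -> j != k ->
  b j <= b i -> (forall p, p != p0 -> l p <= c) -> b j <= c.
Proof.
move=> ij ik jk bji lc; case: (frameK) => skK oK fK.
have [|c1 c2|X [sX X0 X1 hX]] := symmetric_plane_bound (mu := b j) (B := B) (L p0) sA
  _ (axisK_dot ik) (axisK_dot jk) (axisK_neq0 k).
- move=> c1 c2; apply: contra_neq => e.
  have : (axis (K i))^T *m (c1 *: axis (K i) + c2 *: axis (K j)) = 0 by rewrite e mulmx0.
  have : (axis (K j))^T *m (c1 *: axis (K i) + c2 *: axis (K j)) = 0 by rewrite e mulmx0.
  rewrite !mulmxDr -!scalemxAr => /matrixP/(_ 0 0) e2 /matrixP/(_ 0 0) e1.
  have := axisK_norm i; have := axisK_norm j; have := axisK_dot ij.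
  have : ((axis (K j))^T *m axis (K i)) 0 0 = 0 by rewrite axisK_dot // eq_sym.
  move: e1 e2; move: (_ *m axis (K i)) (_ *m axis (K j)) (_ *m axis (K i)) (_ *m axis (K j)).
  move=> m1 m2 m3 m4; rewrite !mxE => e1 e2 z3 z4 n2 n1.
  have c1z : c1 = 0 by move: e1; rewrite z4 n1; lra.
  have c2z : c2 = 0 by move: e2; rewrite z3 n2; lra.
  by rewrite c1z c2z.
- rewrite /= -/(wedge _ _); set W := wedge _ _.
  have [-> ->] := fK W (wedge_skew _ _).
  apply: weighted_sum_ge => p; have [->//|pi] := eqVneq p i.
  have [->//|pj] := eqVneq p j.
  case/negP; apply/eqP; apply: wedge_axis; right.
  by case/or3P: (ord3_cases p ij ik jk) pi pj => /eqP->; rewrite ?eqxx.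
apply: le_bound hX _ => // p; have [->|pp _] := eqVneq p p0; last exact: lc.
by rewrite X1 eqxx.
Qed.

Lemma symmetric_third_ge i j k p0 p1 c : i != j -> i != k -> j != k ->
  b k <= b i -> b k <= b j -> (forall p, p != p0 -> p != p1 -> l p <= c) -> b k <= c.
Proof.
move=> ij ik jk bki bkj lc; case: (frameK) => skK oK fK.
(* The space bound requires a strict inequality, so [mu] lies halfway between [c] and [b k]; then
   [mu <= c] is contradictory. *)
rewrite leNgt; apply/negP => ck; pose mu := (c + b k) / 2.
have [|X [sX X0 X1 X2 hX]] := symmetric_space_bound (mu := mu) (L p0) (L p1) sA sB.
  move=> W sW W0; have [-> nW] := fK W sW.
  apply: (@lt_le_trans _ _ (b k * \tr (W^T *m W))).
    by rewrite ltr_pM2r ?mxnorm_gt0 // /mu; lra.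
  rewrite nW; apply: weighted_sum_ge => p _.
  by case/or3P: (ord3_cases p ij ik jk) => /eqP->.
have : mu <= c; last by rewrite /mu; lra.
apply: le_bound hX _ => // p; have [->|pp] := eqVneq p p0; first by rewrite X1 eqxx.
have [->|pp1 _] := eqVneq p p1; first by rewrite X2 eqxx.
exact: lc.
Qed.

End Comparison.

(** * Matrices as vectors and the quadratic forms of Kronecker products *)

Section Vectorization.
Variables (R : realType) (n : nat).
Implicit Types (X Y A B : 'M[R]_n).

Definition unvec (x : 'cV[R]_(n * n)) : 'M[R]_n :=
  \matrix_(i, j) x (mxtens_index (j, i)) 0.

Lemma unvecK x : vec (unvec x) = x.
Proof.
apply/colP => k; rewrite !mxE -[X in _ = x X 0]mxtens_unindexK.
by congr (x (mxtens_index _) _); case: (mxtens_unindex k).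
Qed.

Lemma vecK X : unvec (vec X) = X.
Proof. by apply/matrixP => i j; rewrite !mxE mxtens_indexK. Qed.

Lemma vec_dot X Y : ((vec X)^T *m vec Y) 0 0 = \tr (X^T *m Y).
Proof.
rewrite mxtrace_trmx_mul exchange_big pair_big /= (reindex (@mxtens_unindex n n)) /=.
  by rewrite mxE; apply: eq_bigr => k _; rewrite !mxE.
by exists (@mxtens_index n n) => ? _; rewrite (mxtens_indexK, mxtens_unindexK).
Qed.

Lemma vec_eq0 X : (vec X == 0) = (X == 0).
Proof.
apply/eqP/eqP => [v0|->]; last by apply/colP => k; rewrite !mxE.
by rewrite -[X]vecK v0; apply/matrixP => i j; rewrite !mxE.
Qed.

Lemma symm_space_vecP X : reflect (X^T = X) ((vec X)^T <= symm_space)%MS.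
Proof.
apply: (iffP (symm_spaceP _)); rewrite commutation_mx_vec; last by move=> ->.
by move=> e; rewrite -[LHS]vecK e vecK.
Qed.

Lemma vecN X : vec (- X) = - vec X.
Proof. by apply/colP => k; rewrite !mxE. Qed.

Lemma skew_space_vecP X : reflect (X^T = - X) ((vec X)^T <= skew_space)%MS.
Proof.
apply: (iffP (skew_spaceP _)); rewrite commutation_mx_vec -vecN; last by move=> ->.
by move=> e; rewrite -[LHS]vecK e vecK.
Qed.

Lemma tensmx_form A B X :
  ((vec X)^T *m (A *t B) *m vec X) 0 0 = \tr (X^T *m B *m X *m A^T).
Proof. by rewrite -mulmxA tensmx_vec vec_dot !mulmxA. Qed.

(** In both cases [X^T A X = X A X^T]; transposing and cycling the trace then exchanges [A] and
    [B]. *)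
Lemma mxtrace_form_swap A B X : A^T = A -> B^T = B -> X^T = X \/ X^T = - X ->
  \tr (X^T *m B *m X *m A) = \tr (X^T *m A *m X *m B).
Proof.
move=> sA sB sX; have -> : X^T *m A *m X = X *m A *m X^T.
  by case: sX => ->; rewrite // !mulNmx mulmxN.
by rewrite -[LHS]mxtrace_tr !trmx_mul trmxK sA sB !mulmxA [LHS]mxtrace_mulC !mulmxA.
Qed.

Lemma kron_sym_form A B X : A^T = A -> B^T = B -> X^T = X \/ X^T = - X ->
  ((vec X)^T *m kron_sym A B *m vec X) 0 0 = 2 * \tr (X^T *m A *m X *m B).
Proof.
move=> sA sB sX; rewrite /kron_sym mulmxDr mulmxDl mxE !tensmx_form sA sB.
by rewrite (mxtrace_form_swap sA sB sX); ring.
Qed.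

Lemma trmx_kron_sym A B : A^T = A -> B^T = B -> (kron_sym A B)^T = kron_sym A B.
Proof. by move=> sA sB; rewrite /kron_sym linearD /= !trmx_tens sA sB. Qed.

End Vectorization.

(** * Orthonormal eigenframes on invariant subspaces *)

Section Eigenframe.
Variable R : realType.

(** The compression [N] of [C] to the orthonormal basis [G] of [V] is symmetric; diagonalizing it
    and lifting back by [Q = U G] gives the frame. The division by 2 undoes the factor in
    [kron_sym_form]. *)
Lemma eigenframe_exists n (A B : 'M[R]_n) r (E : 'I_r -> 'M[R]_n) V :
  A^T = A -> B^T = B ->
  (forall i j, \tr ((E i)^T *m E j) = (i == j)%:R) ->
  (V :=: \matrix_i (vec (E i))^T)%MS -> stablemx V (kron_sym A B)^T ->
  (forall X, ((vec X)^T <= V)%MS -> X^T = X \/ X^T = - X) ->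
  exists (l : r.-tuple R) (L : 'I_r -> 'M[R]_n),
  [/\ eigenvalues_on V (kron_sym A B) l, forall i, ((vec (L i))^T <= V)%MS,
      forall i j, \tr ((L i)^T *m L j) = (i == j)%:R
    & forall X, ((vec X)^T <= V)%MS ->
      \tr (X^T *m A *m X *m B) = \sum_i tnth l i / 2 * \tr (X^T *m L i) ^+ 2 /\
      \tr (X^T *m X) = \sum_i \tr (X^T *m L i) ^+ 2].
Proof.
move=> sA sB oE; set G := \matrix_i _ => eV stV symV; set C := kron_sym A B in stV *.
have sC : C^T = C by exact: trmx_kron_sym.
have GG : G *m G^T = 1%:M.
  apply/matrixP => i j; rewrite [RHS]mxE -oE -vec_dot !mxE.
  by apply: eq_bigr => k _; rewrite !mxE.
have subG x : (x <= V)%MS -> x = x *m G^T *m G.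
  by rewrite eV => /submxP[y ->]; rewrite -mulmxA -mulmxA [G *m _]mulmxA GG mul1mx.
have fG : row_free G by apply/row_freeP; exists G^T.
pose N := G *m C *m G^T.
have sN : N^T = N by rewrite /N !trmx_mul trmxK sC mulmxA.
have [U [l [sl UU NE]]] := sorted_diagonalization sN.
(* The rows of [G C^T] lie in [V] by stability, and [G^T G] fixes them; hence [N] is the matrix of
   the restriction. *)
have GC : G *m C^T = N *m G.
  have : (G *m C^T <= V)%MS.
    by apply: submx_trans stV; rewrite submxMr // eV.
  by rewrite sC /N; exact: subG.
pose Q := U *m G; pose L i := unvec (row i Q)^T.
have LE i : (vec (L i))^T = row i Q by rewrite unvecK trmxK.
have UU' : U^T *m U = 1%:M by apply: mulmx1C.
exists l, L; split.
- split=> //; rewrite (char_poly_conjmx_eqmx (row_base_free V) fG).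
  + by rewrite (conjmx_intertwine fG GC) NE char_poly_diagonalized.
  + by apply: eqmx_trans (eq_row_base V) eV.
  + by rewrite GC submxMl.
- by move=> i; rewrite LE eV /Q row_mul submxMl.
- move=> i j; rewrite -vec_dot -[vec (L j)]trmxK !LE.
  have QQ : Q *m Q^T = 1%:M.
    by rewrite /Q trmx_mul mulmxA -[U *m G *m _]mulmxA GG mulmx1 UU.
  transitivity ((Q *m Q^T) i j); last by rewrite QQ mxE.
  by rewrite [LHS]mxE [RHS]mxE; apply: eq_bigr => k _; rewrite !mxE.
move=> X XV; have y i : ((vec X)^T *m Q^T) 0 i = \tr (X^T *m L i).
  rewrite -vec_dot -[vec (L i)]trmxK LE !mxE.
  by apply: eq_bigr => k _; rewrite !mxE.
have XG := subG _ _ XV; set x := (vec X)^T *m G^T in XG.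
have vX : vec X = (x *m G)^T by rewrite -XG trmxK.
have xQ : x *m U^T = (vec X)^T *m Q^T by rewrite /Q trmx_mul mulmxA.
split.
  have two : (2 : R) != 0 by rewrite pnatr_eq0.
  apply: (mulfI two); rewrite -kron_sym_form //; last exact: symV.
  rewrite -/C [in LHS]vX trmxK trmx_mul mulmxA -[x *m G *m C]mulmxA.
  rewrite -[x *m (G *m C) *m _]mulmxA -/N NE.
  rewrite quadratic_diagonalized mulr_sumr; apply: eq_bigr => i _.
  by rewrite xQ y mxE; field.
rewrite -vec_dot [in LHS]vX trmxK trmx_mul mulmxA -[x *m G *m _]mulmxA GG mulmx1.
rewrite (dotmx_orthogonal _ UU).
by apply: eq_bigr => i _; rewrite xQ y.
Qed.

End Eigenframe.

(** * Orthonormal bases of the symmetric and the skew 3 x 3 matrices *)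

Section Bases.
Variable R : realType.

(** An off-diagonal entry is counted twice in the Frobenius norm, hence this normalization. *)
Definition inv_sqrt2 : R := (Num.sqrt 2)^-1.

Lemma inv_sqrt2_sqr : inv_sqrt2 * inv_sqrt2 = 2^-1.
Proof. by rewrite /inv_sqrt2 -invfM -expr2 sqr_sqrtr. Qed.

Lemma inv_sqrt2_neq0 : inv_sqrt2 != 0.
Proof. by rewrite invr_eq0 sqrtr_eq0 -ltNge. Qed.

Definition sym_basis (r : 'I_6) : 'M[R]_3 :=
  nth 0 [:: sym3 1 0 0 0 0 0; sym3 0 0 0 1 0 0; sym3 0 0 0 0 0 1;
            sym3 0 inv_sqrt2 0 0 0 0; sym3 0 0 inv_sqrt2 0 0 0;
            sym3 0 0 0 0 inv_sqrt2 0] r.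

Definition skew_basis (r : 'I_3) : 'M[R]_3 :=
  nth 0 [:: skew3 inv_sqrt2 0 0; skew3 0 inv_sqrt2 0; skew3 0 0 inv_sqrt2] r.

Lemma sym_basis_orthonormal i j :
  \tr ((sym_basis i)^T *m sym_basis j) = (i == j)%:R.
Proof.
case: i => [[|[|[|[|[|[|//]]]]]] i]; case: j => [[|[|[|[|[|[|//]]]]]] j];
  rewrite /sym_basis /= trmx_sym3 mxtrace_sym3; have := inv_sqrt2_sqr; lra.
Qed.

Lemma skew_basis_orthonormal i j :
  \tr ((skew_basis i)^T *m skew_basis j) = (i == j)%:R.
Proof.
case: i => [[|[|[|//]]] i]; case: j => [[|[|[|//]]] j];
  rewrite /skew_basis /= dot_axis ?trmx_skew3 // !axis_skew3
    !(mxE, big_ord_recl, big_ord0) /=; have := inv_sqrt2_sqr; lra.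
Qed.

Lemma symm_space_basis : (@symm_space R 3 :=: \matrix_i (vec (sym_basis i))^T)%MS.
Proof.
apply/eqmxP/andP; split; apply/row_subP => i; last first.
  rewrite rowK; apply/symm_space_vecP.
  by case: i => [[|[|[|[|[|[|//]]]]]] i]; rewrite /sym_basis /= trmx_sym3.
rewrite -[row _ _]trmxK -[(row _ _)^T]unvecK.
have : ((vec (unvec (row i (@symm_space R 3))^T))^T <= symm_space)%MS.
  by rewrite unvecK trmxK row_sub.
move/symm_space_vecP/sym3P => [x11 [x12 [x13 [x22 [x23 [x33 ->]]]]]].
apply/submxP; exists (\row_r nth 0
  [:: x11; x22; x33; x12 / inv_sqrt2; x13 / inv_sqrt2; x23 / inv_sqrt2] r).
apply/rowP => k; rewrite !(mxE, big_ord_recl, big_ord0) /sym_basis /=.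
(* [k %/ 3] and [k %% 3] are the column and the row stored at position [k]; nine entries are
   checked. *)
have : (k %/ 3 < 3)%N by rewrite ltn_divLR.
have : (k %% 3 < 3)%N by rewrite ltn_mod.
by case: (k %% 3)%N (k %/ 3)%N => [|[|[|//]]] [|[|[|//]]] _ _ /=;
  field; exact: inv_sqrt2_neq0.
Qed.

Lemma skew_space_basis : (@skew_space R 3 :=: \matrix_i (vec (skew_basis i))^T)%MS.
Proof.
apply/eqmxP/andP; split; apply/row_subP => i; last first.
  rewrite rowK; apply/skew_space_vecP.
  by case: i => [[|[|[|//]]] i]; rewrite /skew_basis /= trmx_skew3.
rewrite -[row _ _]trmxK -[(row _ _)^T]unvecK.
have : ((vec (unvec (row i (@skew_space R 3))^T))^T <= skew_space)%MS.
  by rewrite unvecK trmxK row_sub.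
move/skew_space_vecP/skew3P => [w1 [w2 [w3 ->]]].
apply/submxP; exists (\row_r nth 0
  [:: w1 / inv_sqrt2; w2 / inv_sqrt2; w3 / inv_sqrt2] r).
apply/rowP => k; rewrite !(mxE, big_ord_recl, big_ord0) /skew_basis /=.
have : (k %/ 3 < 3)%N by rewrite ltn_divLR.
have : (k %% 3 < 3)%N by rewrite ltn_mod.
by case: (k %% 3)%N (k %/ 3)%N => [|[|[|//]]] [|[|[|//]]] _ _ /=;
  field; exact: inv_sqrt2_neq0.
Qed.

End Bases.

(** * Interlacing and the extreme Rayleigh quotients *)

Section Interlacing.
Variable R : realType.
Implicit Types A B : 'M[R]_3.

Lemma symm_eigenframe A B : A^T = A -> B^T = B ->
  exists (l : 6.-tuple R) L, eigenvalues_on symm_space (kron_sym A B) l /\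
    eigenframe (fun X => X^T = X) A B (fun i => tnth l i / 2) L.
Proof.
move=> sA sB.
have [X /symm_space_vecP ->|l [L [el LV oL fL]]] := eigenframe_exists sA sB
  (@sym_basis_orthonormal R) (@symm_space_basis R) (symm_space_stable A B).
  by left.
exists l, L; split=> //; split=> // [i|X sX]; first exact/symm_space_vecP/LV.
by apply: fL; apply/symm_space_vecP.
Qed.

Lemma skew_eigenframe A B : A^T = A -> B^T = B ->
  exists (b : 3.-tuple R) K, eigenvalues_on skew_space (kron_sym A B) b /\
    eigenframe (fun X => X^T = - X) A B (fun i => tnth b i / 2) K.
Proof.
move=> sA sB.
have [X /skew_space_vecP ->|b [K [eb KV oK fK]]] := eigenframe_exists sA sB
  (@skew_basis_orthonormal R) (@skew_space_basis R) (skew_space_stable A B).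
  by right.
exists b, K; split=> //; split=> // [i|X sX]; first exact/skew_space_vecP/KV.
by apply: fK; apply/skew_space_vecP.
Qed.

(** Passing to [- A] reverses the order of the values, which turns upper comparisons into lower
    ones. *)
Lemma eigenframe_opp Q A B n (l : 'I_n -> R) L :
  eigenframe Q A B l L -> eigenframe Q (- A) B (fun i => - l i) L.
Proof.
move=> [QL oL fL]; split=> // X /fL[fX nX]; split=> //.
rewrite mulmxN !mulNmx raddfN /= fX -sumrN.
by apply: eq_bigr => i _; rewrite mulNr.
Qed.

Lemma sorted_tnth_ge n (l : n.-tuple R) (i j : 'I_n) : sorted >=%R l -> (i <= j)%N ->
  tnth l j <= tnth l i.
Proof.
move=> sl ij; rewrite !(tnth_nth 0).
have ge_trans : transitive (>=%R : rel R) by move=> y x z xy yz; apply: le_trans yz xy.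
have := sorted_leq_nth ge_trans (fun x => lexx x) 0 sl; apply=> //;
  by rewrite inE size_tuple.
Qed.

Lemma eigenframe_interlacing A B (l : 6.-tuple R) L (b : 3.-tuple R) K :
  A^T = A -> B^T = B -> sorted >=%R l -> sorted >=%R b ->
  eigenframe (fun X => X^T = X) A B (fun i => tnth l i / 2) L ->
  eigenframe (fun X => X^T = - X) A B (fun i => tnth b i / 2) K ->
  forall i, (i < 3)%N -> b`_i <= l`_i /\ l`_(3 + i) <= b`_i.
Proof.
move=> sA sB sl sb fL fK.
have sNA : (- A)^T = - A by rewrite linearN /= sA.
have fNL := eigenframe_opp fL; have fNK := eigenframe_opp fK.
have lle (p r : 'I_6) : (p <= r)%N -> tnth l r / 2 <= tnth l p / 2.
  by move=> pr; rewrite ler_pM2r ?invr_gt0 //; exact: sorted_tnth_ge.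
have ble (p r : 'I_3) : (p <= r)%N -> tnth b r / 2 <= tnth b p / 2.
  by move=> pr; rewrite ler_pM2r ?invr_gt0 //; exact: sorted_tnth_ge.
pose o i : 'I_6 := inord i; pose k i : 'I_3 := inord i.
have oE i : (i < 6)%N -> l`_i = tnth l (o i).
  by move=> i6; rewrite (tnth_nth 0) inordK.
have kE i : (i < 3)%N -> b`_i = tnth b (k i).
  by move=> i3; rewrite (tnth_nth 0) inordK.
have half (x y : R) : x / 2 <= y / 2 -> x <= y by rewrite ler_pM2r ?invr_gt0.
have k_neq i j : (i < 3)%N -> (j < 3)%N -> i != j -> k i != k j.
  by move=> i3 j3; rewrite -val_eqE /= !inordK.
have o_val i : (i < 6)%N -> o i = i :> nat by move=> i6; rewrite inordK.
have k_val i : (i < 3)%N -> k i = i :> nat by move=> i6; rewrite inordK.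
have neq_val (p : 'I_6) i : (i < 6)%N -> p != o i -> p != i :> nat.
  by move=> i6; apply: contra_neq => e; apply/val_inj; rewrite /= o_val.
(* At index [i] the bound by [l] from above uses the estimate for dimension [i + 1]; the one from
   below uses dimension [3 - i] for [- A], with both lists read from the end. *)
case=> [|[|[|//]]] _; rewrite !kE // !oE //; split; apply: half.
- apply: (symmetric_top_ge sA fL fK (i := k 0%N) (j := k 1%N) (k := k 2));
    rewrite ?k_neq // => p; apply: lle; rewrite o_val //.
- rewrite -lerN2.
  apply: (symmetric_third_ge sNA sB fNL fNK (i := k 2) (j := k 1%N) (k := k 0%N)
    (p0 := o 5) (p1 := o 4)); rewrite ?k_neq // ?lerN2 ?ble ?k_val //.
  move=> p /neq_val p5 /neq_val p4; rewrite lerN2; apply: lle; rewrite o_val //.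
  by have := ltn_ord p; move: (p5 isT) (p4 isT); lia.
- apply: (symmetric_second_ge sA fL fK (i := k 0%N) (j := k 1%N) (k := k 2)
    (p0 := o 0%N)); rewrite ?k_neq // ?ble ?k_val //.
  move=> p /neq_val p0; apply: lle; rewrite o_val //.
  by move: (p0 isT); lia.
- rewrite -lerN2.
  apply: (symmetric_second_ge sNA fNL fNK (i := k 2) (j := k 1%N) (k := k 0%N)
    (p0 := o 5)); rewrite ?k_neq // ?lerN2 ?ble ?k_val //.
  move=> p /neq_val p5; rewrite lerN2; apply: lle; rewrite o_val //.
  by have := ltn_ord p; move: (p5 isT); lia.
- apply: (symmetric_third_ge sA sB fL fK (i := k 0%N) (j := k 1%N) (k := k 2)
    (p0 := o 0%N) (p1 := o 1%N)); rewrite ?k_neq // ?ble ?k_val //.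
  move=> p /neq_val p0 /neq_val p1; apply: lle; rewrite o_val //.
  by move: (p0 isT) (p1 isT); lia.
- rewrite -lerN2.
  apply: (symmetric_top_ge sNA fNL fNK (i := k 2) (j := k 1%N) (k := k 0%N));
    rewrite ?k_neq // => p; rewrite lerN2; apply: lle; rewrite o_val //.
  by have := ltn_ord p; lia.
Qed.

Local Open Scope classical_set_scope.

Lemma rayleigh_vec A B X : A^T = A -> B^T = B -> X^T = X \/ X^T = - X ->
  rayleigh (A *t B) (vec X) = \tr (X^T *m A *m X *m B) / \tr (X^T *m X).
Proof.
by move=> sA sB sX; rewrite /rayleigh vec_dot tensmx_form sA mxtrace_form_swap.
Qed.

Lemma symm_rayleighE A B : A^T = A -> B^T = B ->
  symm_rayleigh (A *t B) =
  [set \tr (X^T *m A *m X *m B) / \tr (X^T *m X) | X in [set X | X != 0 /\ X^T = X]].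
Proof.
move=> sA sB; apply/seteqP; split=> x [].
  move=> u [u0 /symm_spaceP]; rewrite -[u]unvecK => /symm_space_vecP su <-.
  exists (unvec u); last by rewrite rayleigh_vec //; left.
  by split=> //; rewrite -vec_eq0 unvecK.
move=> X [X0 sX] <-; exists (vec X); last by rewrite rayleigh_vec //; left.
by split; [rewrite vec_eq0|rewrite commutation_mx_vec sX].
Qed.

Lemma skew_rayleighE A B : A^T = A -> B^T = B ->
  skew_rayleigh (A *t B) =
  [set \tr (X^T *m A *m X *m B) / \tr (X^T *m X) | X in [set X | X != 0 /\ X^T = - X]].
Proof.
move=> sA sB; apply/seteqP; split=> x [].
  move=> u [u0 /skew_spaceP]; rewrite -[u]unvecK => /skew_space_vecP su <-.
  exists (unvec u); last by rewrite rayleigh_vec //; right.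
  by split=> //; rewrite -vec_eq0 unvecK.
move=> X [X0 sX] <-; exists (vec X); last by rewrite rayleigh_vec //; right.
by split; [rewrite vec_eq0|rewrite commutation_mx_vec sX vecN].
Qed.

Lemma eigenframe_attained Q A B n (l : 'I_n -> R) L p : eigenframe Q A B l L ->
  [set \tr (X^T *m A *m X *m B) / \tr (X^T *m X) | X in [set X | X != 0 /\ Q X]] (l p).
Proof.
move=> [QL oL fL]; have n1 : \tr ((L p)^T *m L p) = 1 by rewrite oL eqxx.
exists (L p); first by split=> //; rewrite -mxnorm_eq0 n1 oner_eq0.
rewrite n1 divr1 (fL _ (QL p)).1 (bigD1 p) //= n1 expr1n mulr1 big1 ?addr0 // => i ip.
by rewrite oL eq_sym (negbTE ip) expr0n mulr0.
Qed.

Lemma eigenframe_max Q A B n (l : 'I_n -> R) L p : eigenframe Q A B l L ->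
  (forall i, l i <= l p) ->
  is_max [set \tr (X^T *m A *m X *m B) / \tr (X^T *m X)
    | X in [set X | X != 0 /\ Q X]] (l p).
Proof.
move=> fL lp; split; first exact: eigenframe_attained fL.
move=> _ [X [X0 QX] <-]; rewrite ler_pdivrMr ?mxnorm_gt0 //.
by case: fL => _ _ /(_ X QX)[-> ->]; exact: weighted_sum_le.
Qed.

Lemma eigenframe_min Q A B n (l : 'I_n -> R) L p : eigenframe Q A B l L ->
  (forall i, l p <= l i) ->
  is_min [set \tr (X^T *m A *m X *m B) / \tr (X^T *m X)
    | X in [set X | X != 0 /\ Q X]] (l p).
Proof.
move=> fL lp; split; first exact: eigenframe_attained fL.
move=> _ [X [X0 QX] <-]; rewrite ler_pdivlMr ?mxnorm_gt0 //.
by case: fL => _ _ /(_ X QX)[-> ->]; exact: weighted_sum_ge.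
Qed.

End Interlacing.

Theorem proposition6 (R : realType) (A B : 'M[R]_3) :
  A^T = A -> B^T = B -> weak_interlacing A B /\ interlacing A B.
Proof.
move=> sA sB; have [l [L [el fL]]] := symm_eigenframe sA sB.
have [b [K [eb fK]]] := skew_eigenframe sA sB.
have sl := proj1 el; have sb := proj1 eb.
have inter := eigenframe_interlacing sA sB sl sb fL fK.
split; last first.
  by exists l, b; split=> // i i3; have [] := inter i i3.
have half (x y : R) : x <= y -> x / 2 <= y / 2 by rewrite ler_pM2r ?invr_gt0.
(* The lists are nonincreasing, so [ord_max] gives the minima and [ord0] the maxima; on both spaces
   the form of [A *t B] is half that of [kron_sym A B]. *)
exists (tnth l ord_max / 2), (tnth b ord_max / 2), (tnth l ord0 / 2), (tnth b ord0 / 2).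
rewrite symm_rayleighE // skew_rayleighE //; split; first split.
- apply: eigenframe_min fL _ => i.
  by apply: half; apply: sorted_tnth_ge sl _; rewrite -ltnS ltn_ord.
- apply: eigenframe_min fK _ => i.
  by apply: half; apply: sorted_tnth_ge sb _; rewrite -ltnS ltn_ord.
- by apply: eigenframe_max fL _ => i; apply: half; exact: sorted_tnth_ge sl _.
- by apply: eigenframe_max fK _ => i; apply: half; exact: sorted_tnth_ge sb _.
by split; apply: half; rewrite !(tnth_nth 0);
  [have [] := inter 2 isT|have [] := inter 0%N isT].
Qed.
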